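(* Let $n\ge 1$ and let $f_1,\dots,f_n\in VTL_n(d)$ be the elements defined inductively by $f_1=1_n$ and, for $2\le i\le n$, $$f_i=x_{i-1}f_{i-1}+y_{i-1}f_{i-1}e_{i-1}f_{i-1}+z_{i-1}f_{i-1}v_{i-1}f_{i-1},$$ where $x_i=\frac{1}{i+1}$, $y_i=-\frac{2i}{(i+1)(d+2i-2)}$, $z_i=\frac{i}{i+1}$ for $i\ge 0$. Put $\alpha_{i-1}=x_{i-1}d+y_{i-1}+z_{i-1}$. Then the following hold. (1) For $1\le i\le n$: $f_i^2=f_i$. (2) For $1\le i\le n-1$: $f_{i+1}f_i=f_if_{i+1}=f_{i+1}$. (3) For $1\le i\le n$ and $1\le k<i$: $f_ie_k=e_kf_i=0$. (4) For $1\le i\le n$ and $1\le k<i$: $f_iv_k=v_kf_i=f_i$. (5) For $1\le i\le n-1$: $(e_if_i)^2=\alpha_{i-1}e_if_i$ and $(f_ie_i)^2=\alpha_{i-1}f_ie_i$. (6) For $1\le i\le n-1$: $f_iv_if_iv_if_i=x_{i-1}f_i+y_{i-1}f_ie_if_i+z_{i-1}f_iv_if_i$. (7) For $1\le i\le n-1$: $e_if_iv_if_i=(x_{i-1}+y_{i-1})e_if_i$ and $f_iv_if_ie_i=(x_{i-1}+y_{i-1})f_ie_i$.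
   Context: Let $d$ be an indeterminate and $K=\mathbb{C}(d)$; all denominators $d+2i-2$ are then nonzero. The virtual Temperley-Lieb algebra $VTL_n(d)$ is the unital associative $K$-algebra (isomorphic to the Brauer algebra with parameter $d$) with $K$-basis the set of all $(2n-1)!!$ diagrams (''connection elements''), i.e. perfect matchings of $2n$ points consisting of $n$ top points $1,\dots,n$ and $n$ bottom points $1,\dots,n$. The product $XY$ of diagrams is obtained by stacking $X$ above $Y$, identifying the bottom points of $X$ with the top points of $Y$, replacing each closed loop formed by a factor $d$; crossings of arcs carry no information. The identity $1_n$ joins top $j$ to bottom $j$ for all $j$. For $1\le i\le n-1$: $e_i$ joins top $i$ to top $i+1$, bottom $i$ to bottom $i+1$, and top $j$ to bottom $j$ for $j\ne i,i+1$; $v_i$ joins top $i$ to bottom $i+1$, top $i+1$ to bottom $i$, and top $j$ to bottom $j$ for $j\ne i,i+1$. *)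

(* Defs.v *)
From HB Require Import structures.
From mathcomp Require Import all_boot all_order all_algebra.
From mathcomp Require Import perm reals.
From mathcomp Require Import complex.
Set Implicit Arguments.
Unset Strict Implicit.
Unset Printing Implicit Defensive.
Import GRing.Theory.
Local Open Scope ring_scope.

(* [(true, j)] is the top point number [j + 1], [(false, j)] the bottom point
   number [j + 1]. *)
Definition point (n : nat) : finType := (bool * 'I_n)%type.

(* A perfect matching is a fixed-point-free involution. *)
Record diagram (n : nat) := Diagram {
  mate :> {ffun point n -> point n};
  _ : [forall p, (mate p != p) && (mate (mate p) == p)] }.

HB.instance Definition _ n := [isSub for @mate n].
HB.instance Definition _ n := [Finite of diagram n by <:].

Definition arcs (n : nat) (V : finType) (g : point n -> V) (X : diagram n) :
  rel V := fun u v => [exists p, (g p == u) && (g (X p) == v)].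

(* Vertices of a stacked pair of diagrams: the outer points, which are the top
   points of the upper diagram and the bottom points of the lower one, and one
   vertex for each pair of identified points. *)
Definition vertex (n : nat) : finType := (point n + 'I_n)%type.

Definition attach (n : nat) (b : bool) (p : point n) : vertex n :=
  if p.1 == b then inl p else inr p.2.

Definition stack (n : nat) (X Y : diagram n) : rel (vertex n) :=
  relU (arcs (attach true) X) (arcs (attach false) Y).

(* The other outer point of the component of [p]; it exists and is unique by
   [bstack_outer] below. *)
Definition partner (n : nat) (X Y : diagram n) (p : point n) : point n :=
  odflt p [pick q | (q != p) && connect (stack X Y) (inl p) (inl q)].

Definition closed_comps (n : nat) (M : finType) (e : rel (point n + M)) : nat :=
  n_comp e [pred v | [forall p, ~~ connect e (inl p) v]].

HB.lock Definition loops (n : nat) (X Y : diagram n) : nat :=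
  closed_comps (stack X Y).
Canonical loops_unlockable := Unlockable loops.unlock.

Section Diagrams.
Variable n : nat.
Implicit Types (X Y Z A B C P : diagram n) (p q : point n) (b c : bool).

Lemma mateK X : involutive X.
Proof. by move=> p; case: X => f /= /forallP/(_ p)/andP[_ /eqP]. Qed.

Lemma mate_neq X p : X p != p.
Proof. by case: X => f /= /forallP/(_ p)/andP[]. Qed.

Lemma diagramP X Y : X =1 Y <-> X = Y.
Proof. by split=> [eqXY | -> //]; apply/val_inj/ffunP. Qed.

Lemma arcs_sym (V : finType) (g : point n -> V) X : symmetric (arcs g X).
Proof.
move=> u v; apply/existsP/existsP => -[p /andP[/eqP<- /eqP<-]];
  by exists (X p); rewrite mateK !eqxx.
Qed.

Lemma arcs_mate (V : finType) (g : point n -> V) X p : arcs g X (g p) (g (X p)).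
Proof. by apply/existsP; exists p; rewrite !eqxx. Qed.

Lemma relU_sym (V : Type) (e e' : rel V) :
  symmetric e -> symmetric e' -> symmetric (relU e e').
Proof. by move=> se se' u v /=; rewrite se se'. Qed.

Lemma connect_ind (V : finType) (e : rel V) (Q : V -> Prop) u v :
  Q u -> (forall x y, e x y -> Q x -> Q y) -> connect e u v -> Q v.
Proof.
move=> Qu Qe /connectP[p + ->]; elim: p u Qu => //= x p IHp u Qu.
by case/andP=> /Qe/(_ Qu)/IHp.
Qed.

End Diagrams.

Section TwoInvolutions.
Variables (T : finType) (s t : T -> T).
Hypotheses (sK : involutive s) (tK : involutive t).
Let e := relU (frel s) (frel t).

Lemma two_involutions (a : T) : t a = a -> s a != a ->
  exists c, [/\ c != a, connect e a c, (s c == c) || (t c == c) &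
    forall r, connect e a r -> (s r == r) || (t r == r) -> r = a \/ r = c].
Proof.
move=> ta sa; pose f := t \o s; pose z j := iter j f a.
have injf : injective f by apply: inj_comp; apply: inv_inj.
pose m := fingraph.order f a.
have zm : z m = a by apply: iter_order.
have m_gt0 : (0 < m)%N by apply: fingraph.order_gt0.
have z_inj i j : (i < m)%N -> (j < m)%N -> z i = z j -> i = j.
  move=> lti ltj eqz; have /uniqP := orbit_uniq f a => /(_ a).
  rewrite /orbit; move=> /(_ i j); rewrite !inE size_traject => ->//.
  by rewrite !nth_traject.
have ftf x : f (t (f x)) = t x by rewrite /f /= tK sK.
have ft j : iter j f (t (z j)) = a.
  by elim: j => [|j IHj]; rewrite // iterSr /z iterS ftf.
have inj_it k : injective (iter k f) by elim: k => // k IHk x y /= /injf/IHk.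
have tz j : (j <= m)%N -> t (z j) = z (m - j)%N.
  move=> lej; have: iter j f (t (z j)) = iter j f (z (m - j)%N).
    by rewrite ft /z -iterD subnKC // -/(z m) zm.
  exact: inj_it.
have sz j : (j < m)%N -> s (z j) = z (m - j.+1)%N.
  by move=> ltj; rewrite -tz // /z iterS /f /= tK.
have ez j : connect e a (z j).
  elim: j => // j /connect_trans; apply.
  apply: (@connect_trans _ _ (s (z j))); apply: connect1;
    by rewrite /e /= eqxx ?orbT.
have con r : connect e a r -> exists2 j, (j < m)%N & r = z j.
  apply: (@connect_ind _ e (fun x => exists2 j, (j < m)%N & x = z j)).
    by exists 0%N.
  move=> x y /orP[] /= /eqP<- [j ltj ->].
    by exists (m - j.+1)%N; rewrite ?sz // ltn_subrL m_gt0.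
  case: j ltj => [|j] ltj; first by exists 0%N; rewrite // /z /= ta.
  by exists (m - j.+1)%N; rewrite ?tz ?ltn_subrL // ltnW.
have m_gt1 : (1 < m)%N.
  rewrite ltn_neqAle m_gt0 andbT; apply: contraNneq sa => m1.
  by have := sz 0%N m_gt0; rewrite -m1 /= => ->.
have ltm2 : (m./2 < m)%N by rewrite ltn_half_double -addnn -{1}[m]add0n ltn_add2r.
clearbody m.
have z0 : z 0%N = a by [].
clearbody z; exists (z m./2); split=> //.
- apply: contraTneq m_gt1 => eqz; have m20 := z_inj _ 0%N ltm2 m_gt0 (etrans eqz (esym z0)).
  by rewrite -[m]odd_double_half m20 double0 addn0 -leqNgt leq_b1.
- rewrite (sz _ ltm2) (tz _ (ltnW ltm2)).
  case: (boolP (odd m)) => om; apply/orP.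
    left; apply/eqP; congr (z _).
    by rewrite -{1}[m]odd_double_half om add1n subSS -addnn addnK.
  right; apply/eqP; congr (z _).
  by rewrite -{1}[m]odd_double_half (negPf om) add0n -addnn addnK.
move=> r /con[j ltj ->]; rewrite sz // tz; last exact: ltnW.
case/orP=> /eqP.
  move/z_inj; rewrite ltn_subrL m_gt0 => /(_ isT ltj) mj; right; congr (z _).
  have: m = j.*2.+1 by rewrite -addnn -addnS -{1}mj subnK.
  by move=> ->; rewrite /= uphalf_double.
case: j ltj => [|j ltj]; first by left.
move/z_inj; rewrite ltn_subrL m_gt0 => /(_ isT ltj) mj; right; congr (z _).
have: m = j.+1.*2 by rewrite -addnn -{1}mj subnK // ltnW.
by move=> ->; rewrite doubleK.
Qed.

End TwoInvolutions.

Section BiasedStack.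
Variable n : nat.
Implicit Types (A B C P : diagram n) (p q : point n) (b c : bool).

Definition bstack b A B : rel (vertex n) :=
  relU (arcs (attach b) A) (arcs (attach (~~ b)) B).

Lemma bstack_sym b A B : connect_sym (bstack b A B).
Proof. by apply/sym_connect_sym/relU_sym; apply: arcs_sym. Qed.

Lemma bstackN b A B : bstack b A B =2 bstack (~~ b) B A.
Proof. by move=> u v; rewrite /bstack /= negbK orbC. Qed.

Lemma attach_inj b : injective (@attach n b).
Proof.
move=> [c i] [c' j]; rewrite /attach /=.
case: eqP => [->|neb]; case: eqP => [->|neb'] // -[] -> //.
by congr pair; move: neb neb'; case: b c c' => -[] [].
Qed.

Definition bwalk b A (v : vertex n) : vertex n :=
  match v with
  | inl p => if p.1 == b then attach b (A p) else inl p
  | inr j => attach b (A (~~ b, j))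
  end.

Lemma bwalk_attach b A p : bwalk b A (attach b p) = attach b (A p).
Proof.
rewrite {1}/attach; case: ifP => [/= ->//|/negbT nb] /=; congr (attach b (A _)).
by case: p nb => c j /=; case: b c => -[].
Qed.

Lemma bwalk_fix b A p : p.1 = ~~ b -> bwalk b A (inl p) = inl p.
Proof. by move=> /= ->; case: b. Qed.

Lemma vertexP b (v : vertex n) :
  (exists p, v = attach b p) \/ (exists2 p, p.1 = ~~ b & v = inl p).
Proof.
case: v => [[c j]|j]; last by left; exists (~~ b, j); case: b.
case: (altP (c =P b)) => [->|nb]; first by left; exists (b, j); rewrite /attach /= eqxx.
by right; exists (c, j) => //=; case: b c nb => -[].
Qed.

Lemma bwalkK b A : involutive (bwalk b A).
Proof.
move=> v; case: (vertexP b v) => [[p ->]|[p pb ->]].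
  by rewrite !bwalk_attach mateK.
by rewrite !bwalk_fix.
Qed.

Lemma bwalk_outer b A v : bwalk b A v = v -> exists2 p, p.1 = ~~ b & v = inl p.
Proof.
case: (vertexP b v) => [[p ->]|//].
by rewrite bwalk_attach => /attach_inj/eqP; rewrite (negPf (mate_neq _ _)).
Qed.

Lemma bwalk_neq b A p : p.1 = b -> bwalk b A (inl p) != inl p.
Proof.
by move=> pb; apply/eqP => /bwalk_outer[q qb [pq]]; move: qb; rewrite -pq pb; case: b {pb}.
Qed.

Lemma bwalk_connect b A B :
  connect (bstack b A B) =2 connect (relU (frel (bwalk b A)) (frel (bwalk (~~ b) B))).
Proof.
have sub1 c D v : connect (arcs (attach c) D) v (bwalk c D v).
  case: (vertexP c v) => [[p ->]|[p pb ->]]; last by rewrite bwalk_fix.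
  by rewrite bwalk_attach; apply/connect1/arcs_mate.
move=> u v; apply/idP/idP; move: u v; apply: connect_sub => u v /orP[] /=.
- by case/existsP=> p /andP[/eqP<- /eqP<-]; rewrite -(bwalk_attach b) connect1 //= eqxx.
- by case/existsP=> p /andP[/eqP<- /eqP<-]; rewrite -(bwalk_attach (~~b)) connect1 //= eqxx orbT.
- move/eqP<-; move: (sub1 b A u); apply: connect_sub => x y xy.
  by apply: connect1; rewrite /bstack /= xy.
- move/eqP<-; move: (sub1 (~~ b) B u); apply: connect_sub => x y xy.
  by apply: connect1; rewrite /bstack /= xy orbT.
Qed.

Lemma bstack_outer b A B p : exists q, [/\ q != p,
  connect (bstack b A B) (inl p) (inl q) &
  forall r, connect (bstack b A B) (inl p) (inl r) -> r = p \/ r = q].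
Proof.
wlog pb : b A B / p.1 = b => [IH|].
  case: (altP (p.1 =P b)) => [/IH //|pnb].
  have /IH : p.1 = ~~ b by case: (p.1) b pnb => -[].
  move=> /(_ B A)[q [qp con uq]]; exists q; split=> //.
    by rewrite (eq_connect (bstackN b A B)).
  by move=> r; rewrite (eq_connect (bstackN b A B)); apply: uq.
have [|/=|c [cp con fc uc]] :=
  two_involutions (bwalkK b A) (bwalkK (~~ b) B) (a := inl p).
- by rewrite bwalk_fix // negbK.
- exact: bwalk_neq.
have [q cq] : exists q, c = inl q.
  by case/orP: fc => /eqP/bwalk_outer[q _ ->]; exists q.
exists q; split; first by apply: contraNneq cp => <-; rewrite cq.
  by rewrite bwalk_connect -cq.
move=> r; rewrite bwalk_connect => /uc[|[]|].
- case: (altP (r.1 =P b)) => rb; apply/orP; last first.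
    by left; apply/eqP/bwalk_fix; case: (r.1) (b) rb => -[].
  by right; apply/eqP/bwalk_fix; rewrite negbK.
- by left.
- by rewrite cq => -[]; right.
Qed.

End BiasedStack.

Section Partner.
Variable n : nat.
Implicit Types (X Y Z : diagram n) (p q : point n).

Lemma partnerP X Y p q :
  connect (stack X Y) (inl p) (inl q) = (p == q) || (partner X Y p == q).
Proof.
have [r [rp con uq]] := bstack_outer true X Y p.
have {r rp con uq} [rp con uq] : [/\ partner X Y p != p,
    connect (stack X Y) (inl p) (inl (partner X Y p)) &
    forall r, connect (stack X Y) (inl p) (inl r) -> r = p \/ r = partner X Y p].
  rewrite /partner; case: pickP => [r' /andP[r'p con']|/(_ r)] /=; last first.
    by rewrite rp con.
  split=> // q' /[dup] con'' /uq[->|->]; [by left | right].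
  by case: (uq _ con') => // eqr; rewrite eqr eqxx in r'p.
apply/idP/orP => [/uq[->|->]|[/eqP<-|/eqP<-] //]; [by left | by right].
Qed.

Lemma partner_neq X Y p : partner X Y p != p.
Proof.
have [r [rp con _]] := bstack_outer true X Y p.
by rewrite /partner; case: pickP => [? /andP[]|/(_ r)] //=; rewrite rp con.
Qed.

Fact compose_subproof X Y :
  [forall p, ([ffun p => partner X Y p] p != p) &&
    ([ffun p => partner X Y p] ([ffun p => partner X Y p] p) == p)].
Proof.
apply/forallP => p; rewrite !ffunE partner_neq /=.
have: connect (stack X Y) (inl (partner X Y p)) (inl p).
  by rewrite (bstack_sym true) partnerP eqxx orbT.
by rewrite partnerP (negPf (partner_neq _ _ _)).
Qed.

End Partner.

HB.lock Definition compose (n : nat) (X Y : diagram n) : diagram n :=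
  Diagram (compose_subproof X Y).
Canonical compose_unlockable := Unlockable compose.unlock.

Lemma composeE n (X Y : diagram n) p : compose X Y p = partner X Y p.
Proof. by rewrite unlock ffunE. Qed.

Lemma loopsE n (X Y : diagram n) : loops X Y = closed_comps (stack X Y).
Proof. by rewrite unlock. Qed.

Lemma connect_stack n (X Y : diagram n) p q :
  connect (stack X Y) (inl p) (inl q) = (p == q) || (compose X Y p == q).
Proof. by rewrite partnerP composeE. Qed.

Section Associativity.
Variable n : nat.
Implicit Types (A B C P X Y Z : diagram n) (p q : point n) (b c : bool).

Definition attach3 c p : point n + point n :=
  if p.1 == c then inl p else inr (c, p.2).

Definition stack3 b A B C : rel (point n + point n) :=
  relU (relU (arcs (attach3 b) A) (arcs inr B)) (arcs (attach3 (~~ b)) C).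

Lemma stack3_sym b A B C : connect_sym (stack3 b A B C).
Proof.
by apply/sym_connect_sym/relU_sym; [apply: relU_sym|]; apply: arcs_sym.
Qed.

Lemma stack3N b A B C : stack3 b A B C =2 stack3 (~~ b) C B A.
Proof.
move=> u v; rewrite /stack3 /= negbK.
by case: (arcs _ _ _ _); case: (arcs _ _ _ _); case: (arcs _ _ _ _).
Qed.

Lemma closed_comps_closed (M : finType) (e : rel (point n + M)) :
  connect_sym e -> closed e [pred v | [forall p, ~~ connect e (inl p) v]].
Proof.
move=> sym_e u v euv; rewrite !inE; apply: eq_forallb => p; congr (~~ _).
by apply: (same_connect_r sym_e); apply: connect1.
Qed.

Lemma eq_closed_comps (M : finType) (e e' : rel (point n + M)) :
  connect e =2 connect e' -> closed_comps e = closed_comps e'.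
Proof.
move=> eqe; rewrite /closed_comps (eq_n_comp eqe); apply: eq_n_comp_r => v.
by rewrite !inE; apply: eq_forallb => p; rewrite eqe.
Qed.

Section Contract.
Variables (b : bool) (A B C P : diagram n).
Hypothesis connP : forall p q,
  connect (bstack b A B) (inl p) (inl q) = (p == q) || (P p == q).

Let h (v : vertex n) : point n + point n :=
  match v with inl p => inl p | inr j => inr (~~ b, j) end.
Let k (v : vertex n) : point n + point n :=
  match v with
  | inl p => if p.1 == b then inl p else inr p
  | inr j => inr (b, j)
  end.
Let G := stack3 b A B C.
Let e := bstack b P C.
Let e1 := bstack b A B.
Let symG : connect_sym G := @stack3_sym b A B C.
Let syme : connect_sym e := @bstack_sym n b P C.
Let syme1 : connect_sym e1 := @bstack_sym n b A B.

Let negb_eq c : (c == b) = false -> c = ~~ b.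
Proof. by case: c b => -[]. Qed.

Let k_attach p : k (attach b p) = attach3 b p.
Proof. by case: p => c j; rewrite /attach /attach3; case: ifP => //= ->. Qed.

Let k_attachN p : k (attach (~~ b) p) = inr p.
Proof.
case: p => c j; rewrite /attach /=; case: ifP => [/eqP->|] /=.
  by case: (b).
by move/negbT; case: c (b) => -[].
Qed.

Let h_attach p : h (attach b p) = k (inl p).
Proof.
case: p => c j; rewrite /attach /=; case: ifP => //= /negb_eq.
by move=> ->.
Qed.

Let h_attachN p : h (attach (~~ b) p) = attach3 (~~ b) p.
Proof. by rewrite /attach /attach3; case: ifP. Qed.

Let h_inj : injective h.
Proof. by case=> [p|i] [q|j] //= [] ->. Qed.

Let k_inj : injective k.
Proof.
case=> [p|i] [q|j] /=.
- by case: ifP => _; case: ifP => _ // -[->].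
- by case: ifP => // + [pE]; rewrite pE /= eqxx.
- by case: ifP => // + [qE]; rewrite -qE /= eqxx.
- by case=> ->.
Qed.

Let G_lift u v : e1 u v -> G (k u) (k v).
Proof.
case/orP=> /existsP[p /andP[/eqP<- /eqP<-]].
  by rewrite !k_attach /G /stack3 /= arcs_mate.
by rewrite !k_attachN /G /stack3 /= arcs_mate orbT.
Qed.

Let G_liftC u v : connect e1 u v -> connect G (k u) (k v).
Proof.
apply: (@connect_ind _ e1 (fun v => connect G (k u) (k v))) => [|x y exy]; first exact: connect0.
by move/connect_trans; apply; apply/connect1/G_lift.
Qed.

Let G_lower x y : G x y ->
  (exists u v, [/\ e1 u v, x = k u & y = k v]) \/
  (exists p, x = h (attach (~~ b) p) /\ y = h (attach (~~ b) (C p))).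
Proof.
case/orP=> [/orP[]|] /existsP[p /andP[/eqP<- /eqP<-]]; last first.
- by right; exists p; rewrite !h_attachN.
- left; exists (attach (~~ b) p), (attach (~~ b) (B p)); rewrite !k_attachN.
  by split=> //; rewrite /e1 /bstack /= arcs_mate orbT.
left; exists (attach b p), (attach b (A p)); rewrite !k_attach.
by split=> //; rewrite /e1 /bstack /= arcs_mate.
Qed.

Let e_mate p q : connect e1 (inl p) (inl q) -> connect e (attach b p) (attach b q).
Proof.
rewrite connP => /orP[] /eqP <-; first exact: connect0.
by apply: connect1; rewrite /e /bstack /= arcs_mate.
Qed.

Let hk u v : h u = k v -> exists2 p, u = attach b p & v = inl p.
Proof.
case: v => [p|j]; first by rewrite -h_attach => /h_inj ->; exists p.
by case: u => //= i [] /eqP; case: (b).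
Qed.

Let G_lower_k u w : G (k u) w -> (exists p, u = inl p) \/
  exists2 u', w = k u' & e1 u u'.
Proof.
case/G_lower=> [[u1 [v1 [e1uv /k_inj-> ->]]]|[p [/esym/hk[q _ ->] _]]].
  by right; exists v1.
by left; exists q.
Qed.

Let G_lower_kC v w : connect G (k v) w -> (exists p, connect e1 v (inl p)) \/
  exists2 v', w = k v' & connect e1 v v'.
Proof.
apply: (@connect_ind _ G (fun w => (exists p, connect e1 v (inl p)) \/
  exists2 v', w = k v' & connect e1 v v')) => [|x y Gxy].
  by right; exists v; rewrite ?connect0.
case=> [|[v' def_x e1vv']]; first by left.
move: Gxy; rewrite def_x => /G_lower_k[[p def_v']|[u -> e1v'u]].
  by left; exists p; rewrite -def_v'.
by right; exists u => //; apply: connect_trans e1vv' (connect1 e1v'u).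
Qed.

Let G1 : rel (point n + point n) := relU (arcs (attach3 b) A) (arcs inr B).

Let G1_h u v : connect G1 (h u) (h v) -> connect e u v.
Proof.
case: (vertexP b u) => [[p ->]|[p pb ->]].
  rewrite h_attach => /(@connect_ind _ G1
    (fun w => exists2 w', w = k w' & connect e1 (inl p) w'))[||w].
  - by exists (inl p); rewrite ?connect0.
  - move=> x y G1xy [x' def_x e1x].
    move: G1xy; rewrite def_x /G1 /= => /orP[] /existsP[q /andP[/eqP+ /eqP<-]].
      rewrite -k_attach => /k_inj def_x'; exists (attach b (A q)).
        by rewrite k_attach.
      apply: connect_trans e1x (connect1 _).
      by rewrite -def_x' /e1 /bstack /= arcs_mate.
    rewrite -k_attachN => /k_inj def_x'; exists (attach (~~ b) (B q)).
      by rewrite k_attachN.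
    apply: connect_trans e1x (connect1 _).
    by rewrite -def_x' /e1 /bstack /= arcs_mate orbT.
  by case/hk=> q -> -> /e_mate.
move=> conn; suff /h_inj <- : h (inl p) = h v by apply: connect0.
move: conn; apply: (@connect_ind _ G1 (fun w => h (inl p) = w)) => // x y + def_x.
rewrite -def_x /= => /orP[] /existsP[q /andP[/eqP + _]] //.
rewrite /attach3; case: ifP => // /eqP qb [] def_q; move: qb.
by rewrite def_q pb; case: (b).
Qed.

Let functor_h u v : connect e u v = connect G (h u) (h v).
Proof.
apply/idP/idP.
  apply: (@connect_ind _ e (fun v => connect G (h u) (h v))) => [|x y exy].
    exact: connect0.
  move/connect_trans; apply; move: exy => /orP[] /existsP[p /andP[/eqP<- /eqP<-]].
    by rewrite !h_attach; apply: G_liftC; rewrite connP eqxx orbT.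
  by rewrite !h_attachN; apply: connect1; rewrite /G /stack3 /= arcs_mate orbT.
move=> /(@connect_ind _ G (fun w => exists2 q, connect e u q & connect G1 (h q) w))[||q].
- by exists u; rewrite connect0.
- move=> x y Gxy [q euq G1qx]; case/orP: (Gxy) => [G1xy|].
    by exists q => //; apply: connect_trans G1qx (connect1 G1xy).
  case/existsP=> p /andP[/eqP def_x /eqP <-]; move: G1qx.
  rewrite -def_x -!h_attachN => /G1_h eqp; exists (attach (~~ b) (C p)) => //.
  apply: connect_trans euq (connect_trans eqp (connect1 _)).
  by rewrite /e /bstack /= arcs_mate orbT.
by move=> /connect_trans euq /G1_h; apply: euq.
Qed.

Lemma contract_connect p q :
  connect (bstack b P C) (inl p) (inl q) =
  connect (stack3 b A B C) (inl p) (inl q).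
Proof. exact: functor_h. Qed.

Lemma contract_loops : closed_comps (stack3 b A B C) =
  (closed_comps (bstack b A B) + closed_comps (bstack b P C))%N.
Proof.
pose O := [pred w | [forall p, ~~ connect G (inl p) w]].
pose a0 := [pred w | [forall u, ~~ connect G (h u) w]].
pose a1 := [pred w | (w \in O) && (w \notin a0)].
have cl_O : closed G O by apply: closed_comps_closed.
have cl_a0 : closed G a0.
  move=> x y Gxy; rewrite !inE; apply: eq_forallb => u; congr (~~ _).
  by apply: (same_connect_r symG); apply: connect1.
have cl_a1 : closed G a1.
  by move=> x y Gxy; rewrite inE [RHS]inE (cl_O _ _ Gxy) (cl_a0 _ _ Gxy).
have -> : closed_comps (stack3 b A B C) = (n_comp G a0 + n_comp G a1)%N.
  rewrite /closed_comps /n_comp_mem -/G -/O -(cardID a0); congr addn.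
    apply: eq_card => w; rewrite !inE; case: (roots G w) => //=.
    apply/andP/idP => [[]//|a0w]; split=> //; apply/forallP => p.
    exact: (forallP a0w (inl p)).
  by apply: eq_card => w; rewrite !inE; case: (roots G w); rewrite ?andbF // andbC.
congr addn.
  have a0k x : (k x \in a0) -> ~ exists p, connect e1 x (inl p).
    move=> a0x [p xp]; move: (forallP a0x (attach b p)).
    by rewrite h_attach symG G_liftC.
  rewrite (adjunction_n_comp k symG syme1 cl_a0); last first.
    split=> [w a0w | x y a0x].
      case: w a0w => [p|[c j]] a0w.
        by have := forallP a0w (inl p); rewrite connect0.
      case: (altP (c =P b)) => [->|ncb]; first by exists (inr j); apply: connect0.
      have def_c : ~~ b = c by case: (c) (b) ncb => -[].
      by have := forallP a0w (inr j); rewrite /= def_c connect0.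
    apply/idP/idP => [/G_liftC //|/G_lower_kC[/(a0k _ a0x)//|[y' /k_inj-> //]]].
  apply: eq_n_comp_r => v; rewrite !inE; apply/forallP/forallP => [a0v p | cv u].
    by apply: contra (a0v (attach b p)); rewrite h_attach; apply: G_liftC.
  rewrite symG; apply/negP => /G_lower_kC[[p]|[v' /hk[p _ ->]]];
    by rewrite syme1 (negPf (cv p)).
rewrite (adjunction_n_comp h symG syme cl_a1); last first.
  split=> [w|x y _]; last exact: functor_h.
  rewrite !inE => /andP[_]; rewrite negb_forall => /existsP/sigW[u].
  by rewrite negbK => Guw; exists u; rewrite symG.
apply: eq_n_comp_r => v; rewrite !inE.
have -> : [forall u, ~~ connect G (h u) (h v)] = false.
  by apply/negbTE; rewrite negb_forall; apply/existsP; exists v; rewrite connect0.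
by rewrite andbT; apply: eq_forallb => p; rewrite functor_h.
Qed.

End Contract.

Lemma composite_inj (D D' : diagram n) : (forall p q,
    (p == q) || (D p == q) = (p == q) || (D' p == q)) -> D = D'.
Proof.
move=> eqD; apply/diagramP => p; have := eqD p (D p).
by rewrite eqxx orbT eq_sym (negPf (mate_neq D p)) => /esym/eqP.
Qed.

Let bstackNC X Y : connect (bstack false Y X) =2 connect (stack X Y).
Proof. by apply: eq_connect => u v; rewrite bstackN. Qed.

Let connN X Y p q :
  connect (bstack false Y X) (inl p) (inl q) = (p == q) || (compose X Y p == q).
Proof. by rewrite bstackNC connect_stack. Qed.

Lemma composeA X Y Z : compose X (compose Y Z) = compose (compose X Y) Z.
Proof.
apply: composite_inj => p q; rewrite -!connect_stack -bstackNC.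
rewrite (contract_connect X (connN Y Z)).
rewrite (contract_connect (b := true) Z (@connect_stack _ X Y)).
by apply: eq_connect => u v; rewrite stack3N.
Qed.

Lemma loopsA X Y Z : (loops Y Z + loops X (compose Y Z) =
  loops X Y + loops (compose X Y) Z)%N.
Proof.
rewrite !loopsE; transitivity (closed_comps (stack3 true X Y Z)); last first.
  exact: (contract_loops (b := true) Z (@connect_stack _ X Y)).
have := contract_loops X (connN Y Z).
rewrite (eq_closed_comps (@bstackNC Y Z)).
rewrite (eq_closed_comps (@bstackNC X (compose Y Z))) => <-.
by apply: eq_closed_comps; apply: eq_connect => u v; rewrite stack3N.
Qed.

End Associativity.

Section Identity.
Variable n : nat.
Implicit Types (X : diagram n) (p q : point n) (b : bool).

Fact id_diagram_subproof : let f := [ffun p => (~~ p.1, p.2)] in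
  [forall p : point n, (f p != p) && (f (f p) == p)].
Proof.
by apply/forallP => -[c j]; rewrite !ffunE /= negbK eqxx andbT; case: c.
Qed.

Definition id_diagram : diagram n := Diagram id_diagram_subproof.

Lemma compose_eq X Y p q :
  q != p -> connect (stack X Y) (inl p) (inl q) -> compose X Y p = q.
Proof. by rewrite connect_stack eq_sym => /negPf-> /eqP. Qed.

Lemma bstack_id b X p :
  connect (bstack b id_diagram X) (inl p) (attach (~~ b) p).
Proof.
case: p => c j; case: (altP (c =P b)) => [->|ncb]; last first.
  have -> : c = ~~ b by case: c b ncb => -[].
  by rewrite /attach /= eqxx.
have -> : attach (~~ b) (b, j) = attach b (id_diagram (b, j)).
  by rewrite ffunE /attach /=; case: b.
have -> : inl (b, j) = attach b (b, j) by rewrite /attach /= eqxx.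
by apply: connect1; rewrite /bstack /= arcs_mate.
Qed.

Lemma bstack_id_mate b X p :
  connect (bstack b id_diagram X) (inl p) (inl (X p)).
Proof.
apply: connect_trans (bstack_id b X p) _; rewrite bstack_sym.
apply: connect_trans (bstack_id b X (X p)) _; rewrite bstack_sym.
by apply: connect1; rewrite /bstack /= arcs_mate orbT.
Qed.

Lemma bstack_id_loops b X : closed_comps (bstack b id_diagram X) = 0%N.
Proof.
apply: eq_card0 => v; rewrite !inE; apply/negP => /andP[_ /forallP cv].
case: v cv => [p|j] /=; first by move/(_ p); rewrite connect0.
move/(_ (b, j)); have := bstack_id b X (b, j).
by rewrite /attach /=; case: b => /= ->.
Qed.

Let bstackNC X Y : connect (bstack false Y X) =2 connect (stack X Y).
Proof. by apply: eq_connect => u v; rewrite bstackN. Qed.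

Lemma compose1l X : compose id_diagram X = X.
Proof.
by apply/diagramP => p; apply: compose_eq (bstack_id_mate true X p); apply: mate_neq.
Qed.

Lemma compose1r X : compose X id_diagram = X.
Proof.
apply/diagramP => p; apply: compose_eq; first exact: mate_neq.
by rewrite -bstackNC bstack_id_mate.
Qed.

Lemma loops1l X : loops id_diagram X = 0%N.
Proof. by rewrite loopsE; apply: (bstack_id_loops true). Qed.

Lemma loops1r X : loops X id_diagram = 0%N.
Proof.
by rewrite loopsE -(bstack_id_loops false X); apply/esym/eq_closed_comps/bstackNC.
Qed.

End Identity.

(* The algebra on the formal linear combinations of diagrams, over any
   commutative ring and with any loop value [d]; [basis X] is the basis element
   of [X]. *)
Definition vtl (K : comNzRingType) (d : K) (n : nat) : Type :=
  {ffun diagram n -> K}.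

HB.instance Definition _ (K : comNzRingType) (d : K) n :=
  GRing.Lmodule.copy (vtl d n) {ffun diagram n -> K^o}.

Section Algebra.
Variables (K : comNzRingType) (d : K) (n : nat).
Implicit Types (X Y Z : diagram n) (a b c : vtl d n).

Definition basis X : vtl d n := [ffun Y => (Y == X)%:R].

Definition vtl_mul a b : vtl d n :=
  \sum_X \sum_Y (a X * b Y * d ^+ loops X Y) *: basis (compose X Y).

Lemma vtl_expand a : a = \sum_X a X *: basis X.
Proof.
apply/ffunP => Y; rewrite sum_ffunE (bigD1 Y) //= big1 => [|X nXY].
  by rewrite !ffunE eqxx addr0 [RHS]mulr1.
by rewrite !ffunE eq_sym (negPf nXY) [LHS]mulr0.
Qed.

Lemma vtl_ind (Q : vtl d n -> Prop) :
    Q 0 -> (forall a b, Q a -> Q b -> Q (a + b)) ->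
  (forall k X, Q (k *: basis X)) -> forall a, Q a.
Proof. by move=> Q0 QD QZ a; rewrite (vtl_expand a); elim/big_ind: _. Qed.

Let mulDl : left_distributive vtl_mul +%R.
Proof.
move=> a b c; rewrite -big_split; apply: eq_bigr => X _ /=.
rewrite -big_split; apply: eq_bigr => Y _ /=.
by rewrite -scalerDl ffunE !mulrDl.
Qed.

Let mulDr : right_distributive vtl_mul +%R.
Proof.
move=> a b c; rewrite -big_split; apply: eq_bigr => X _ /=.
rewrite -big_split; apply: eq_bigr => Y _ /=.
by rewrite -scalerDl ffunE mulrDr mulrDl.
Qed.

Let scaleAl k a b : k *: vtl_mul a b = vtl_mul (k *: a) b.
Proof.
rewrite /vtl_mul scaler_sumr; apply: eq_bigr => X _; rewrite scaler_sumr.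
by apply: eq_bigr => Y _; rewrite scalerA ffunE /= !mulrA.
Qed.

Let scaleAr k a b : k *: vtl_mul a b = vtl_mul a (k *: b).
Proof.
rewrite /vtl_mul scaler_sumr; apply: eq_bigr => X _; rewrite scaler_sumr.
by apply: eq_bigr => Y _; rewrite scalerA ffunE /= !mulrA [k * _]mulrC.
Qed.

Let mul_basis X Y :
  vtl_mul (basis X) (basis Y) = d ^+ loops X Y *: basis (compose X Y).
Proof.
rewrite /vtl_mul (bigD1 X) //= (bigD1 Y) //= !ffunE !eqxx !mul1r.
rewrite big1 ?addr0 => [|Z nZ]; last first.
  by rewrite !ffunE (negPf nZ) mulr0 mul0r scale0r.
rewrite big1 ?addr0 // => Z nZ; rewrite big1 // => Z' _.
by rewrite !ffunE (negPf nZ) !mul0r scale0r.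
Qed.

Let mul0 a : vtl_mul 0 a = 0.
Proof. by rewrite -(scale0r 0) -scaleAl !scale0r. Qed.

Let mulr0 a : vtl_mul a 0 = 0.
Proof. by rewrite -(scale0r 0) -scaleAr !scale0r. Qed.

Let mul_basisA X Y Z :
  vtl_mul (basis X) (vtl_mul (basis Y) (basis Z)) =
  vtl_mul (vtl_mul (basis X) (basis Y)) (basis Z).
Proof.
rewrite (mul_basis Y Z) (mul_basis X Y) -scaleAr -scaleAl.
rewrite (mul_basis X (compose Y Z)) (mul_basis (compose X Y) Z).
by rewrite composeA 2!scalerA -2!exprD (loopsA X Y Z).
Qed.

Let mulA : associative vtl_mul.
Proof.
move=> a b c; elim/vtl_ind: a => [|a a' IH IH'|k X]; first by rewrite !mul0.
  by rewrite !mulDl IH IH'.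
rewrite -3!scaleAl; congr (k *: _).
elim/vtl_ind: b => [|b b' IH IH'|k' Y]; first by rewrite !(mul0, mulr0).
  by rewrite mulDl !mulDr mulDl IH IH'.
rewrite -(scaleAl k' (basis Y)) -2!scaleAr -scaleAl; congr (k' *: _).
elim/vtl_ind: c => [|c c' IH IH'|k'' Z]; first by rewrite !mulr0.
  by rewrite !mulDr IH IH'.
by rewrite -3!scaleAr mul_basisA.
Qed.

Let mul1 : left_id (basis (id_diagram n)) vtl_mul.
Proof.
elim/vtl_ind => [|a b IH IH'|k X]; first by rewrite mulr0.
  by rewrite mulDr IH IH'.
by rewrite -scaleAr mul_basis compose1l loops1l expr0 scale1r.
Qed.

Let mulr1 : right_id (basis (id_diagram n)) vtl_mul.
Proof.
elim/vtl_ind => [|a b IH IH'|k X]; first by rewrite mul0.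
  by rewrite mulDl IH IH'.
by rewrite -scaleAl mul_basis compose1r loops1r expr0 scale1r.
Qed.

Let one_neq0 : basis (id_diagram n) != 0.
Proof.
by apply/eqP => /ffunP/(_ (id_diagram n))/eqP; rewrite !ffunE eqxx oner_eq0.
Qed.

HB.instance Definition _ := GRing.Zmodule_isNzRing.Build (vtl d n)
  mulA mul1 mulr1 mulDl mulDr one_neq0.
HB.instance Definition _ := GRing.Lmodule_isLalgebra.Build K (vtl d n) scaleAl.
HB.instance Definition _ := GRing.Lalgebra_isAlgebra.Build K (vtl d n) scaleAr.

Lemma basis1 : basis (id_diagram n) = 1.
Proof. by []. Qed.

Lemma basisM X Y :
  basis X * basis Y = d ^+ loops X Y *: basis (compose X Y).
Proof. exact: mul_basis. Qed.

End Algebra.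

(* The transposition of the positions numbered [i] and [i + 1], which are
   [i - 1] and [i] in ['I_n]; the identity unless [1 <= i <= n - 1]. *)
Definition adj_tperm (n i : nat) : {perm 'I_n} :=
  match insub i.-1, insub i with
  | Some j, Some j' => tperm j j'
  | _, _ => 1%g
  end.

Section Generators.
Variables (n i : nat).

Let adjK : involutive (adj_tperm n i).
Proof.
move=> j; rewrite /adj_tperm.
by case: insub => [?|]; first case: insub => [?|]; rewrite ?perm1 ?tpermK.
Qed.

Fact hook_diagram_subproof :
  let f := [ffun p => if adj_tperm n i p.2 == p.2 then (~~ p.1, p.2)
                      else (p.1, adj_tperm n i p.2)] in
  [forall p : point n, (f p != p) && (f (f p) == p)].
Proof.
apply/forallP => -[c j]; rewrite !ffunE /=; case: ifP => /= tj.
  by rewrite tj negbK eqxx andbT; case: c.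
by rewrite adjK [j == _]eq_sym tj xpair_eqE eqxx tj eqxx.
Qed.

(* Joins the positions moved by [adj_tperm] on each side, and every other top
   point to the bottom point below it. *)
Definition hook_diagram : diagram n := Diagram hook_diagram_subproof.

Fact cross_diagram_subproof :
  let f := [ffun p => (~~ p.1, adj_tperm n i p.2)] in
  [forall p : point n, (f p != p) && (f (f p) == p)].
Proof.
by apply/forallP => -[c j]; rewrite !ffunE /= negbK adjK eqxx andbT; case: c.
Qed.

Definition cross_diagram : diagram n := Diagram cross_diagram_subproof.

End Generators.

(* $\mathbb{C}(d)$, the complex numbers being [R[i]] for the real numbers [R],
   and the indeterminate $d$ in it. *)
Definition ratfun (R : realType) : fieldType := {fraction {poly R[i]}}.

Definition dvar (R : realType) : ratfun R := tofrac 'X.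

Definition VTL (R : realType) (n : nat) : algType (ratfun R) := vtl (dvar R) n.

Definition vtl_e (R : realType) (n i : nat) : VTL R n :=
  basis (dvar R) (hook_diagram n i).

Definition vtl_v (R : realType) (n i : nat) : VTL R n :=
  basis (dvar R) (cross_diagram n i).

Definition coef_x (R : realType) (i : nat) : ratfun R := i.+1%:R^-1.

Definition coef_y (R : realType) (i : nat) : ratfun R :=
  - ((2 * i)%:R / (i.+1%:R * (dvar R + (2 * i)%:R - 2))).

Definition coef_z (R : realType) (i : nat) : ratfun R := i%:R / i.+1%:R.

Definition coef_alpha (R : realType) (i : nat) : ratfun R :=
  coef_x R i * dvar R + coef_y R i + coef_z R i.

(* Main.v *)
Require Import Defs.
From HB Require Import structures.
From mathcomp Require Import all_boot all_order all_algebra.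
From mathcomp Require Import reals.
From mathcomp Require Import perm fingroup complex.
From mathcomp Require Import ring zify.
Set Implicit Arguments.
Unset Strict Implicit.
Unset Printing Implicit Defensive.
Import GRing.Theory Num.Theory.
Local Open Scope ring_scope.

(* Write [G], [F], [W] for [f (i - 1)], [f i], [f (i + 1)]. Expanding one [F] in
   terms of [G], which commutes with [e i] and [v i] and is absorbed by [F],
   reduces [e F e F], [e F v F] and [F v F v F] to the Brauer relations on three
   strands; these are (5), (7) and (6). Substituting them in the recursion for
   [W] gives [F W = W], [e W = 0] and [F v W = W] by identities between the
   coefficients, hence [W W = W]; expanding [F] once more in [F v W = W] yields
   [v W = W]. The mirror images of these facts are the same facts in the
   opposite algebra. *)

(** * The opposite algebra *)

Section OppositeAlgebra.
Variables (K : fieldType) (A : algType K).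

(** A new name for the carrier, so that a second product can be declared on it. Terms stay
    convertible, and facts pass between the two algebras without a morphism. *)
Definition opposite : Type := A.

HB.instance Definition _ := GRing.Lmodule.copy opposite A.

Definition opposite_mul (a b : opposite) : opposite := (b : A) * (a : A).

Let mulA : associative opposite_mul.
Proof. by move=> a b c; apply/esym/mulrA. Qed.

Let mulDl : left_distributive opposite_mul +%R.
Proof. by move=> a b c; apply: mulrDr. Qed.

Let mulDr : right_distributive opposite_mul +%R.
Proof. by move=> a b c; apply: mulrDl. Qed.

HB.instance Definition _ := GRing.Zmodule_isNzRing.Build opposite
  mulA (@mulr1 A) (@mul1r A) mulDl mulDr (@oner_neq0 A).

Let scaleAl (k : K) (a b : opposite) :
  k *: opposite_mul a b = opposite_mul (k *: a) b.
Proof. exact: (@scalerAr K A). Qed.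

Let scaleAr (k : K) (a b : opposite) :
  k *: opposite_mul a b = opposite_mul a (k *: b).
Proof. exact: (@scalerAl K A). Qed.

HB.instance Definition _ := GRing.Lmodule_isLalgebra.Build K opposite scaleAl.
HB.instance Definition _ := GRing.Lalgebra_isAlgebra.Build K opposite scaleAr.

End OppositeAlgebra.

(** * Products of hooks and crosses with projectors, on three strands *)

Section ThreeStrands.
Variables (K : fieldType) (A : algType K) (d x y z : K) (G e' v' e v F : A).
Hypotheses (vv : v * v = 1) (ee : e * e = d *: e).
Hypotheses (ev : e * v = e) (ve : v * e = e) (eve : e * v' * e = e).
Hypotheses (conj_e : v * e' * v = v' * e * v').
Hypotheses (braid : v * v' * v = v' * v * v').
Hypotheses (Ge : G * e = e * G) (Gv : G * v = v * G).
Hypotheses (defF : F = x *: G + y *: (G * e' * G) + z *: (G * v' * G)).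
Hypotheses (GF : G * F = F) (e'F : e' * F = 0) (v'F : v' * F = F).

(** The left side is [e * (v * e' * v) * v]; the conjugation relation followed by [e * v' * e = e]
    shortens it. *)
Lemma hook_hook_cross : e * e' = e * v' * v.
Proof.
by rewrite -{1}ev -[LHS]mulr1 -vv !mulrA -2!(mulrA e) conj_e !mulrA eve.
Qed.

(** Only the left [F] is expanded. In each term the last [G] crosses [w] and is absorbed by the
    right [F], while a first [G], if there is another, crosses [e] to the front. *)
Let expand w : w * G = G * w -> e * F * w * F =
  x *: (e * w * F) + y *: (G * (e * e' * w * F)) + z *: (G * (e * v' * w * F)).
Proof.
have rot a : w * G = G * w -> e * (G * a * G) * w * F = G * (e * a * w * F).
  by move=> wG; rewrite !mulrA -Ge -(mulrA _ G) -wG -!mulrA GF.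
move=> wG; have eGwF : e * G * w * F = e * w * F.
  by rewrite -(mulrA e) -wG mulrA -mulrA GF.
by rewrite {1}defF !(mulrDr, mulrDl) -!(scalerAr, scalerAl) !rot // eGwF.
Qed.

Let GeF : G * (e * F) = e * F.
Proof. by rewrite mulrA Ge -mulrA GF. Qed.

(** Case [w = e] of [expand]: the three terms contribute [d], [1] and [1] times [e * F]. *)
Lemma hook_sandwich : e * F * e * F = (x * d + y + z) *: (e * F).
Proof.
rewrite expand ?Ge // ee hook_hook_cross eve -(mulrA _ v) ve eve GeF.
by rewrite -scalerAl scalerA -!scalerDl.
Qed.

(** Case [w = v] of [expand]: rewriting [e * e'] reduces the middle term to [e * F], and the same
    identity read backwards brings [e' * F = 0] into the last term. *)
Lemma hook_cross_sandwich : e * F * v * F = (x + y) *: (e * F).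
Proof.
have evv : e * v' * v * v * F = e * F.
  by rewrite -(mulrA _ v v) vv mulr1 -mulrA v'F.
rewrite expand ?Gv // ev hook_hook_cross evv GeF -hook_hook_cross -(mulrA e) e'F.
by rewrite !mulr0 scaler0 addr0 scalerDl.
Qed.

(** The middle [F] is expanded. The copies of [G] vanish into the outer factors; conjugation by [v]
    becomes conjugation by [v'], which the outer factors absorb too. *)
Lemma cross_cross_sandwich : F * G = F -> F * v' = F -> F * F = F ->
  F * v * F * v * F = x *: F + y *: (F * e * F) + z *: (F * v * F).
Proof.
move=> FG Fv' FF.
have rot a : F * v * (G * a * G) * v * F = F * (v * a * v) * F.
  rewrite !mulrA -(mulrA F v) -Gv (mulrA F) FG -(mulrA _ G) Gv -!mulrA GF.
  by rewrite !mulrA.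
have FvGvF : F * v * G * v * F = F.
  by rewrite -(mulrA F v) -Gv (mulrA F) FG -(mulrA F) vv mulr1 FF.
have v'conj a : F * (v' * a * v') * F = F * a * F.
  by rewrite !mulrA Fv' -(mulrA _ v') v'F.
rewrite {2}defF !(mulrDr, mulrDl) -!(scalerAr, scalerAl) !rot conj_e braid.
by rewrite FvGvF !v'conj.
Qed.

(* Expanding [F] in [W = F * v * W] gives [v * W - x *: W = W - x *: (v * W)]. *)
Lemma cross_fix W : F * W = W -> v' * W = W -> e * W = 0 -> F * v * W = W ->
  1 + x != 0 -> v * W = W.
Proof.
move=> FW v'W eW FvW x1_neq0.
have GW : G * W = W by rewrite -FW mulrA GF.
have rot a : G * a * G * v * W = G * (a * v * W).
  by rewrite -(mulrA _ G) Gv -!mulrA GW.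
have e'vW : e' * v * W = 0.
  have -> : e' * v = v * (v' * e * v') by rewrite -conj_e !mulrA vv mul1r.
  by rewrite -!mulrA v'W eW !mulr0.
have defW : W = x *: (v * W) + z *: (G * (v' * v * W)).
  rewrite -{1}FvW defF !mulrDl -!scalerAl !rot e'vW mulr0 scaler0 addr0.
  by rewrite Gv -(mulrA v) GW.
(* Multiplication by [v] exchanges [W] and [v * W] in the [x]-term; the braid relation and
   [v' * W = W] leave the [z]-term unchanged. *)
have defvW : v * W = x *: W + z *: (G * (v' * v * W)).
  rewrite {1}defW mulrDr -!scalerAr (mulrA v v) vv mul1r (mulrA v G) -Gv -(mulrA G).
  by rewrite !(mulrA v) braid -(mulrA _ v') v'W.
have vW_W : v * W + x *: (v * W) = W + x *: W.
  by rewrite [LHS]addrC {2}defvW addrCA addrC -defW.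
have /eqP : (1 + x) *: (v * W - W) = 0.
  by rewrite scalerBr !scalerDl !scale1r vW_W subrr.
by rewrite scaler_eq0 (negPf x1_neq0) subr_eq0 => /eqP.
Qed.

End ThreeStrands.

(** * Consequences of the recursion for the next projector *)

Section NextProjector.
Variables (K : fieldType) (A : algType K) (x y z x1 y1 z1 a : K) (e v F W : A).
Hypotheses (FF : F * F = F).
Hypotheses (FvFe : F * v * F * e = (x + y) *: (F * e)).
Hypotheses (eFeF : e * F * e * F = a *: (e * F)).
Hypotheses (eFvF : e * F * v * F = (x + y) *: (e * F)).
Hypotheses (FvFvF : F * v * F * v * F =
  x *: F + y *: (F * e * F) + z *: (F * v * F)).
Hypothesis defW : W = x1 *: F + y1 *: (F * e * F) + z1 *: (F * v * F).

Lemma next_projMl : F * W = W.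
Proof. by rewrite {1}defW !mulrDr -!scalerAr !mulrA FF -defW. Qed.

Lemma next_hookMl : x1 + y1 * a + z1 * (x + y) = 0 -> e * W = 0.
Proof.
move=> a0; rewrite defW !mulrDr -!scalerAr !mulrA eFeF eFvF !scalerA -!scalerDl.
by rewrite a0 scale0r.
Qed.

(** The product is a combination of [F], [F * e * F] and [F * v * F]; the three scalar hypotheses
    equate its coefficients with those of [W]. *)
Lemma next_sandwich : z1 * x = x1 -> y1 * (x + y) + z1 * y = y1 ->
  x1 + z1 * z = z1 -> F * v * W = W.
Proof.
move=> zx yy zz; rewrite {1}defW !mulrDr -!scalerAr !mulrA FvFe FvFvF defW.
rewrite -!scalerAl !scalerDr !scalerA zx.
rewrite -[y1 in RHS]yy -[z1 in X in _ = _ + X]zz !scalerDl.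
by rewrite [LHS](AC (2*3) (3*(2*4)*(1*5))).
Qed.

(** In the expansion of the left [W] the [e]-term dies, and the other two give [x1 *: W] and
    [z1 *: W]. *)
Lemma next_idem : F * W = W -> e * W = 0 -> F * v * W = W -> x1 + z1 = 1 ->
  W * W = W.
Proof.
move=> FW eW FvW xz; rewrite {1}defW !mulrDl -!scalerAl -(mulrA (F * e)) FW.
rewrite -(mulrA F e) eW mulr0 scaler0 addr0 -(mulrA (F * v)) FW FvW.
by rewrite -scalerDl xz scale1r.
Qed.

End NextProjector.

(** * Axioms for the generators, the coefficients and the projectors *)

(** Abstract sequences [e] and [v] allow use both in the diagram algebra and in its opposite. *)
Record brauer_relations (K : fieldType) (A : algType K) (d : K) (n : nat)
    (e v : nat -> A) : Prop := BrauerRelations {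
  cross_sq : forall i, (1 <= i < n)%N -> v i * v i = 1;
  hook_sq : forall i, (1 <= i < n)%N -> e i * e i = d *: e i;
  hook_cross : forall i, (1 <= i < n)%N -> e i * v i = e i;
  cross_hook : forall i, (1 <= i < n)%N -> v i * e i = e i;
  cross_braid : forall i, (1 <= i)%N -> (i.+1 < n)%N ->
    v i.+1 * v i * v i.+1 = v i * v i.+1 * v i;
  hook_conj : forall i, (1 <= i)%N -> (i.+1 < n)%N ->
    v i.+1 * e i * v i.+1 = v i * e i.+1 * v i;
  hook_cross_hook : forall i, (1 <= i)%N -> (i.+1 < n)%N ->
    e i.+1 * v i * e i.+1 = e i.+1;
  far_comm : forall i j, (1 <= i)%N -> (i.+1 < j < n)%N ->
    [/\ e i * e j = e j * e i, e i * v j = v j * e i,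
        v i * e j = e j * v i & v i * v j = v j * v i] }.

(** [coef_mulzx], [coef_mulzy] and [coef_mulzz] serve [F * v * W = W], [coef_hook] serves
    [e * W = 0], [coef_addxz] idempotence, and [coef_addx1] the division that yields [v * W = W]. *)
Record projector_coefs (K : fieldType) (d : K) (x y z : nat -> K) : Prop :=
  ProjectorCoefs {
  coefs0 : [/\ x 0%N = 1, y 0%N = 0 & z 0%N = 0];
  coef_addxz : forall i, x i + z i = 1;
  coef_addx1 : forall i, 1 + x i != 0;
  coef_mulzx : forall i, z i.+1 * x i = x i.+1;
  coef_mulzz : forall i, x i.+1 + z i.+1 * z i = z i.+1;
  coef_mulzy : forall i, y i.+1 * (x i + y i) + z i.+1 * y i = y i.+1;
  coef_hook : forall i,
    x i.+1 + y i.+1 * (x i * d + y i + z i) + z i.+1 * (x i + y i) = 0 }.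

(** In the action on tensors, hooks contract and crosses transpose neighbouring factors, so [F] maps
    to tensors that are traceless and symmetric in the first [i] factors. *)
Record traceless_symmetric (K : fieldType) (A : algType K) (e v : nat -> A)
    (i : nat) (F : A) : Prop := TracelessSymmetric {
  ts_idem : F * F = F;
  ts_hook : forall k, (1 <= k < i)%N -> F * e k = 0 /\ e k * F = 0;
  ts_cross : forall k, (1 <= k < i)%N -> F * v k = F /\ v k * F = F }.

Definition projector_rec (K : fieldType) (A : algType K) (n : nat)
    (x y z : nat -> K) (e v f : nat -> A) : Prop :=
  forall i, (1 <= i < n)%N -> f i.+1 =
    x i *: f i + y i *: (f i * e i * f i) + z i *: (f i * v i * f i).

(** * Passage to the opposite algebra *)

Section Opposite.
Variables (K : fieldType) (A : algType K) (d : K) (n : nat).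
Variables (x y z : nat -> K) (e v f : nat -> A).

(** Reversing products exchanges [hook_cross] with [cross_hook]; the three-factor relations are
    palindromic and only need reassociation. *)
Lemma brauer_relations_opposite : brauer_relations d n e v ->
  @brauer_relations K (opposite A) d n e v.
Proof.
case=> h1 h2 h3 h4 h5 h6 h7 h8; split.
- exact: h1.
- exact: h2.
- exact: h4.
- exact: h3.
- move=> i i1 ltin.
  exact: etrans (@mulrA A _ _ _) (etrans (h5 i i1 ltin) (esym (@mulrA A _ _ _))).
- move=> i i1 ltin.
  exact: etrans (@mulrA A _ _ _) (etrans (h6 i i1 ltin) (esym (@mulrA A _ _ _))).
- by move=> i i1 ltin; apply: etrans (@mulrA A _ _ _) (h7 i i1 ltin).
- by move=> i j i1 ltij; case: (h8 i j i1 ltij).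
Qed.

Lemma projector_rec_opposite : projector_rec n x y z e v f ->
  @projector_rec K (opposite A) n x y z e v f.
Proof.
move=> fS i lei; apply: etrans (fS i lei) _.
by congr (_ + _ *: _ + _ *: _); apply: esym (@mulrA A _ _ _).
Qed.

Lemma traceless_symmetric_opposite i F : traceless_symmetric e v i F ->
  @traceless_symmetric K (opposite A) e v i F.
Proof. by case=> h1 h2 h3; split=> // k /[dup] /h2[? ?] /h3[? ?]. Qed.

End Opposite.

(** * The inductive step for a sequence of projectors *)

Section Projectors.
Variables (K : fieldType) (A : algType K) (d : K) (n : nat).
Variables (x y z : nat -> K) (e v f : nat -> A).
Hypotheses (rel : brauer_relations d n e v) (coefs : projector_coefs d x y z).
Hypotheses (f1 : f 1%N = 1) (fS : projector_rec n x y z e v f).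

(** [f i] is built from generators of index below [i], and these commute with those of index
    [m > i]. *)
Lemma projector_comm i m : (1 <= i)%N -> (i < m < n)%N ->
  f i * e m = e m * f i /\ f i * v m = v m * f i.
Proof.
elim: i => // -[_ _ _|i IHi _ ltim]; first by rewrite f1 !mul1r !mulr1.
have [//||Ge Gv] := IHi; first by case/andP: ltim => /ltnW->.
rewrite fS; last by case/andP: ltim => /ltnW/ltnW lti /(leq_trans _)->.
have [|//|ee ev ve vv] := far_comm rel (i := i.+1) (j := m) => //.
have com (a b : A) : f i.+1 * b = b * f i.+1 -> a * b = b * a ->
    f i.+1 * a * f i.+1 * b = b * (f i.+1 * a * f i.+1).
  by move=> fb ab; rewrite -mulrA fb !mulrA -fb -!(mulrA (f _)) -ab.
by rewrite !mulrDl !mulrDr -!scalerAl -!scalerAr !com // Ge Gv.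
Qed.

(** For [i >= 2] the three-strand identities apply with [G = f (i - 1)] and the generators of
    indices [i - 1] and [i]; [i = 1] is checked directly. The guard [1 < i] is there because [f 0]
    is unconstrained. *)
Lemma projector_sandwich i : (1 <= i < n)%N ->
  traceless_symmetric e v i (f i) ->
  ((1 < i)%N -> traceless_symmetric e v i.-1 (f i.-1)) ->
  [/\ e i * f i * e i * f i =
        (x i.-1 * d + y i.-1 + z i.-1) *: (e i * f i),
      e i * f i * v i * f i = (x i.-1 + y i.-1) *: (e i * f i) &
      f i * v i * f i * v i * f i = x i.-1 *: f i
        + y i.-1 *: (f i * e i * f i) + z i.-1 *: (f i * v i * f i)].
Proof.
move=> lti tsF; have [x0 y0 z0] := coefs0 coefs.
case: i lti tsF => [|[|i]] //= lti tsF.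
  rewrite f1 !mulr1 !mul1r x0 y0 z0 !addr0 !scale0r !addr0 !scale1r mul1r.
  by rewrite (hook_sq rel) // (hook_cross rel) // (cross_sq rel).
move=> /(_ isT) tsG.
have lti' : (1 <= i.+1 < n)%N by rewrite (ltnW lti).
have [|Ge Gv] := projector_comm (i := i.+1) (m := i.+2) isT; first by rewrite ltnSn.
have defF := fS lti'.
have GF : f i.+1 * f i.+2 = f i.+2 by apply: next_projMl (ts_idem tsG) defF.
(* The mirror image of [GF], proved in the opposite algebra. *)
have FG : f i.+2 * f i.+1 = f i.+2.
  apply: (@next_projMl K (opposite A)) (ts_idem tsG) _.
  exact: (projector_rec_opposite fS).
have lt1 : (0 < i.+1 < i.+2)%N by rewrite ltnSn.
have [[_ e'F] [Fv' v'F]] := (ts_hook tsF lt1, ts_cross tsF lt1).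
have [vv ee ev ve] := And4 (cross_sq rel (i := i.+2) lti) (hook_sq rel (i := i.+2) lti)
  (hook_cross rel (i := i.+2) lti) (cross_hook rel (i := i.+2) lti).
have [ce br eve] := And3 (hook_conj rel (i := i.+1) isT lti)
  (cross_braid rel (i := i.+1) isT lti) (hook_cross_hook rel (i := i.+1) isT lti).
split.
- exact: hook_sandwich vv ee ev ve eve ce Ge defF GF.
- exact: hook_cross_sandwich vv ev eve ce Ge Gv defF GF e'F v'F.
- exact: cross_cross_sandwich vv ce br Gv defF GF v'F FG Fv' (ts_idem tsF).
Qed.

(** Only products with [f i.+1] on the right are treated; the others come from the opposite algebra,
    which also supplies the last hypothesis. *)
Lemma projector_next i : (1 <= i < n)%N ->
  traceless_symmetric e v i (f i) ->
  ((1 < i)%N -> traceless_symmetric e v i.-1 (f i.-1)) ->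
  f i * v i * f i * e i = (x i.-1 + y i.-1) *: (f i * e i) ->
  f i.+1 * f i.+1 = f i.+1 /\
  forall k, (1 <= k < i.+1)%N -> e k * f i.+1 = 0 /\ v k * f i.+1 = f i.+1.
Proof.
move=> lti tsF tsG FvFe; have [eFeF eFvF FvFvF] := projector_sandwich lti tsF tsG.
have defW := fS lti; have FW := next_projMl (ts_idem tsF) defW.
case: i lti tsF tsG FvFe eFeF eFvF FvFvF defW FW => //= i lti tsF tsG.
move=> FvFe eFeF eFvF FvFvF defW FW.
have eW := next_hookMl eFeF eFvF defW (coef_hook coefs i).
have FvW := next_sandwich FvFe FvFvF defW (coef_mulzx coefs i)
  (coef_mulzy coefs i) (coef_mulzz coefs i).
split; first exact: next_idem defW FW eW FvW (coef_addxz coefs i.+1).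
(* For smaller [k], the claim for [F] carries over to [W = F * W]. *)
move=> k /andP[k1]; rewrite ltnS leq_eqVlt => /orP[/eqP->|ltki]; last first.
  have ltk : (1 <= k < i.+1)%N by rewrite k1.
  by rewrite -FW !mulrA (ts_hook tsF ltk).2 (ts_cross tsF ltk).2 mul0r.
(* At the first index [F = 1], so [F * v * W = W] is already the claim. *)
split=> //; case: i lti tsF tsG FW eW FvW {FvFe eFeF eFvF FvFvF defW} => [|i] /=.
  by rewrite f1 !mul1r.
move=> lti tsF /(_ isT) tsG FW eW FvW.
have lti' : (1 <= i.+1 < n)%N by rewrite (ltnW lti).
have [|_ Gv] := projector_comm (i := i.+1) (m := i.+2) isT; first by rewrite ltnSn.
have lt1 : (0 < i.+1 < i.+2)%N by rewrite ltnSn.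
have v'W : v i.+1 * f i.+3 = f i.+3 by rewrite -FW mulrA (ts_cross tsF lt1).2.
apply: (cross_fix (cross_sq rel (i := i.+2) lti)
  (hook_conj rel (i := i.+1) isT lti) (cross_braid rel (i := i.+1) isT lti) Gv
  (fS lti') (next_projMl (ts_idem tsG) (fS lti')) FW v'W eW FvW).
exact: coef_addx1 coefs i.+1.
Qed.

End Projectors.

(** * The induction, and the identities for all indices *)

Section ProjectorSequence.
Variables (K : fieldType) (A : algType K) (d : K) (n : nat).
Variables (x y z : nat -> K) (e v f : nat -> A).
Hypotheses (rel : brauer_relations d n e v) (coefs : projector_coefs d x y z).
Hypotheses (f1 : f 1%N = 1) (fS : projector_rec n x y z e v f).
Let relo := brauer_relations_opposite rel.
Let fSo := projector_rec_opposite fS.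

(** [projector_sandwich] read in the opposite algebra. *)
Lemma projector_sandwichr i : (1 <= i < n)%N ->
  traceless_symmetric e v i (f i) ->
  ((1 < i)%N -> traceless_symmetric e v i.-1 (f i.-1)) ->
  f i * e i * f i * e i = (x i.-1 * d + y i.-1 + z i.-1) *: (f i * e i) /\
  f i * v i * f i * e i = (x i.-1 + y i.-1) *: (f i * e i).
Proof.
move=> lti tsF tsG.
have [FeFe FvFe _] := projector_sandwich relo coefs f1 fSo lti
  (traceless_symmetric_opposite tsF)
  (fun lt1i => traceless_symmetric_opposite (tsG lt1i)).
by split; rewrite -!mulrA; [apply: FeFe | apply: FvFe].
Qed.

Lemma projector_traceless_symmetric i : (1 <= i <= n)%N ->
  traceless_symmetric e v i (f i).
Proof.
(* The induction carries two consecutive projectors, since the three-strand identities for [f i]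
   involve [f i.-1]. *)
suff ts : (1 <= i <= n)%N -> traceless_symmetric e v i (f i) /\
    ((1 < i)%N -> traceless_symmetric e v i.-1 (f i.-1)).
  by move/ts => [].
elim: i => // -[_ _|i IHi /andP[_ lti]].
  split=> //; rewrite f1; split=> [|k|k]; first by rewrite mulr1.
    by case: k.
  by case: k.
have [|tsF tsG] := IHi; first by rewrite (ltnW lti).
have tsFo := traceless_symmetric_opposite tsF.
have tsGo lt1i := traceless_symmetric_opposite (tsG lt1i).
have [_ eFvF _] := projector_sandwich rel coefs f1 fS (i := i.+1) lti tsF tsG.
have [_ FvFe] := projector_sandwichr (i := i.+1) lti tsF tsG.
have [WW evW] := projector_next rel coefs f1 fS (i := i.+1) lti tsF tsG FvFe.
(* In the opposite algebra the required hypothesis is the identity [eFvF]. *)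
have [] := projector_next relo coefs f1 fSo (i := i.+1) lti tsFo tsGo.
  by rewrite -2!mulrA in eFvF; apply: eFvF.
move=> _ Wev; split=> //=; split=> // k ltk; last first.
  by split; [apply: (Wev k ltk).2 | apply: (evW k ltk).2].
by split; [apply: (Wev k ltk).1 | apply: (evW k ltk).1].
Qed.

Lemma projector_absorb i : (1 <= i < n)%N ->
  f i.+1 * f i = f i.+1 /\ f i * f i.+1 = f i.+1.
Proof.
move=> /[dup] lti /andP[i_gt0 ltin].
have ff : f i * f i = f i.
  by apply/ts_idem/projector_traceless_symmetric; rewrite i_gt0 ltnW.
split; last exact: next_projMl ff (fS lti).
exact: (@next_projMl K (opposite A)) ff (fSo lti).
Qed.

Let ts1 i : (1 <= i < n)%N -> traceless_symmetric e v i (f i).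
Proof.
by move=> /andP[i_gt0 ltin]; apply: projector_traceless_symmetric; rewrite i_gt0 ltnW.
Qed.

Let ts_pred i : (1 <= i < n)%N -> (1 < i)%N ->
  traceless_symmetric e v i.-1 (f i.-1).
Proof. by case: i => [|[|i]] //= ltin _; apply: ts1; apply: ltnW. Qed.

Lemma projector_hook_sq i : (1 <= i < n)%N ->
  (e i * f i) ^+ 2 = (x i.-1 * d + y i.-1 + z i.-1) *: (e i * f i) /\
  (f i * e i) ^+ 2 = (x i.-1 * d + y i.-1 + z i.-1) *: (f i * e i).
Proof.
move=> lti; rewrite !expr2 !mulrA.
have [-> _ _] := projector_sandwich rel coefs f1 fS lti (ts1 lti) (ts_pred lti).
by have [-> _] := projector_sandwichr lti (ts1 lti) (ts_pred lti).
Qed.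

Lemma projector_cross_cross i : (1 <= i < n)%N ->
  f i * v i * f i * v i * f i = x i.-1 *: f i
    + y i.-1 *: (f i * e i * f i) + z i.-1 *: (f i * v i * f i).
Proof.
move=> lti.
by have [] := projector_sandwich rel coefs f1 fS lti (ts1 lti) (ts_pred lti).
Qed.

Lemma projector_hook_cross i : (1 <= i < n)%N ->
  e i * f i * v i * f i = (x i.-1 + y i.-1) *: (e i * f i) /\
  f i * v i * f i * e i = (x i.-1 + y i.-1) *: (f i * e i).
Proof.
move=> lti.
have [_ -> _] := projector_sandwich rel coefs f1 fS lti (ts1 lti) (ts_pred lti).
by have [_ ->] := projector_sandwichr lti (ts1 lti) (ts_pred lti).
Qed.

End ProjectorSequence.

(** * The coefficients *)

Lemma symmetrizer_coefs (K : fieldType) (d : K) :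
  (forall m, m.+1%:R != 0 :> K) -> (forall m, d + (2 * m)%:R - 2 != 0) ->
  projector_coefs d (fun i => i.+1%:R^-1)
    (fun i => - ((2 * i)%:R / (i.+1%:R * (d + (2 * i)%:R - 2))))
    (fun i => i%:R / i.+1%:R).
Proof.
move=> char0 dm.
have c1 i : 1 + i%:R != 0 :> K by rewrite nat1r char0.
have c2 i : 2 + i%:R != 0 :> K by rewrite -natrD char0.
have dm0 i : d + 2 * i%:R - 2 != 0 by rewrite -natrM.
have dm1 i : d + 2 * (1 + i%:R) - 2 != 0 by rewrite nat1r -natrM.
have nat2 i : i.+2%:R = 2 + i%:R :> K by rewrite -natrD.
split.
  by split; rewrite ?muln0 ?mul0r ?oppr0 ?invr1.
(* Once everything is written in terms of [i%:R], [field] meets only the denominators already shown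
   to be nonzero. *)
all: move=> i; rewrite ?natrM ?(nat2 i) -?[i.+1%:R]nat1r.
- by field; rewrite c1.
- rewrite (_ : 1 + (1 + i%:R)^-1 = (2 + i%:R) / (1 + i%:R)).
    by rewrite mulf_neq0 ?invr_eq0.
  by field; rewrite c1.
- by field; rewrite c1 c2.
- by field; rewrite c1 c2.
- by field; rewrite dm0 dm1 c1 c2.
- by field; rewrite dm0 dm1 c1 c2.
Qed.

(** Positive integers are nonzero constants, and [d + 2m - 2] is the image of a polynomial of the
    form ['X - c], which is nonzero. *)
Lemma vtl_coefs (R : realType) :
  projector_coefs (dvar R) (coef_x R) (coef_y R) (coef_z R).
Proof.
apply: symmetrizer_coefs => m.
  rewrite -(rmorph_nat (@tofrac {poly R[i]})) tofrac_eq0 -polyC_natr polyC_eq0.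
  by rewrite pnatr_eq0.
rewrite -(rmorph_nat (@tofrac {poly R[i]})) -[2](rmorph_nat (@tofrac {poly R[i]})).
rewrite -tofracD -tofracB tofrac_eq0 -!polyC_natr -addrA -polyCB -[_%:P]opprK -polyCN.
by rewrite polyXsubC_eq0.
Qed.

(** * Brauer relations for diagrams *)

Lemma adj_tpermK n i : involutive (adj_tperm n i).
Proof.
move=> j; rewrite /adj_tperm.
by case: insub => [?|]; first case: insub => [?|]; rewrite ?perm1 ?tpermK.
Qed.

(** * Stacking a cross on either side *)

Section Cross.
Variables (n i : nat).
Implicit Types (X : diagram n) (p : point n) (b : bool).
Let t := adj_tperm n i.

(** Effect of a cross stacked on side [b]: the outer points of that side are permuted and nothing
    else changes. *)
Definition relabel b p : point n := if p.1 == b then (b, t p.2) else p.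

Lemma relabelK b : involutive (relabel b).
Proof.
case=> c j; rewrite /relabel /=; have [->|/negPf nb] := eqVneq c b.
  by rewrite /= eqxx /= adj_tpermK.
by rewrite /= nb.
Qed.

Let bstack_cross b X p :
  connect (bstack b (cross_diagram n i) X) (inl (relabel b p)) (attach (~~ b) p).
Proof.
case: p => c j; rewrite /relabel /attach /=; case: (altP (c =P b)) => [->|ncb].
  have -> : (b == ~~ b) = false by case: b.
  have -> : inr j = attach b (cross_diagram n i (b, t j)).
    by rewrite ffunE /attach /= adj_tpermK; case: b.
  have -> : inl (b, t j) = attach b (b, t j) by rewrite /attach /= eqxx.
  by apply: connect1; rewrite /bstack /= arcs_mate.
have -> : c == ~~ b by case: c b ncb => -[].
exact: connect0.
Qed.

Lemma bstack_cross_mate b X p :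
  connect (bstack b (cross_diagram n i) X) (inl (relabel b p))
    (inl (relabel b (X p))).
Proof.
apply: connect_trans (bstack_cross b X p) _; rewrite bstack_sym.
apply: connect_trans (bstack_cross b X (X p)) _; rewrite bstack_sym.
by apply: connect1; rewrite /bstack /= arcs_mate orbT.
Qed.

(** Each glued vertex is joined to an outer point through the cross, so no component is closed. *)
Lemma bstack_cross_loops b X :
  closed_comps (bstack b (cross_diagram n i) X) = 0%N.
Proof.
apply: eq_card0 => v; rewrite !inE; apply/negP => /andP[_ /forallP cv].
case: v cv => [p|j] /=; first by move/(_ p); rewrite connect0.
move/(_ (relabel b (b, j))); have := bstack_cross b X (b, j).
by rewrite /attach /=; case: b => /= ->.
Qed.

Let bstackNC X Y : connect (bstack false Y X) =2 connect (stack X Y).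
Proof. by apply: eq_connect => u v; rewrite bstackN. Qed.

Lemma compose_crossl X p :
  compose (cross_diagram n i) X p = relabel true (X (relabel true p)).
Proof.
apply: compose_eq.
  by rewrite (can2_eq (relabelK _) (relabelK _)) mate_neq.
have := bstack_cross_mate true X (relabel true p); rewrite relabelK; exact.
Qed.

Lemma compose_crossr X p :
  compose X (cross_diagram n i) p = relabel false (X (relabel false p)).
Proof.
apply: compose_eq.
  by rewrite (can2_eq (relabelK _) (relabelK _)) mate_neq.
rewrite -bstackNC.
have := bstack_cross_mate false X (relabel false p); rewrite relabelK; exact.
Qed.

Lemma loops_crossl X : loops (cross_diagram n i) X = 0%N.
Proof. by rewrite loopsE; apply: (bstack_cross_loops true). Qed.

Lemma loops_crossr X : loops X (cross_diagram n i) = 0%N.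
Proof.
by rewrite loopsE -(bstack_cross_loops false X); apply/esym/eq_closed_comps/bstackNC.
Qed.

End Cross.

(** * Stacking a hook on top *)

Section Hook.
Variables (n i : nat).
Implicit Types (X : diagram n) (p q : point n).
Let t := adj_tperm n i.
Let E := hook_diagram n i.

(* In the stack of [E] over [X], the top points of [X] glued to the bottom arc
   of [E]; every other outer point runs straight into [X]. *)
Definition capped p := p.1 && (t p.2 != p.2).

Let stack_attach X p : connect (stack E X) (attach false p) (attach false (X p)).
Proof. by apply: connect1; rewrite /stack /= arcs_mate orbT. Qed.

Let free_attach X p : ~~ capped p ->
  connect (stack E X) (inl p) (attach false p).
Proof.
case: p => -[] j; last by rewrite /attach /= connect0.
rewrite /capped /= negbK => /eqP tj.
have -> : inl (true, j) = attach true (true, j) by [].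
have -> : attach false (true, j) = attach true (E (true, j)).
  by rewrite ffunE /= tj eqxx.
by apply: connect1; rewrite /stack /= arcs_mate.
Qed.

(** [E] has the same arc at the top and at the bottom, so [E p] also names the far end of the glued
    bottom arc. *)
Let capped_attach X p : capped p ->
  connect (stack E X) (attach false p) (attach false (E p)).
Proof.
case: p => -[] j //; rewrite /capped /= => tj.
have -> : attach false (true, j) = attach true (false, j) by [].
have -> : attach false (E (true, j)) = attach true (E (false, j)).
  by rewrite !ffunE /= (negPf tj).
by apply: connect1; rewrite /stack /= arcs_mate.
Qed.

Let stack_symC X : connect_sym (stack E X).
Proof. exact: (@bstack_sym n true E X). Qed.

Lemma capped_hook p : capped p -> E p = (true, t p.2).
Proof. by case: p => -[] j //; rewrite /capped ffunE /= => /negPf->. Qed.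

Lemma compose_hook_capped X p : capped p -> compose E X p = E p.
Proof.
move=> cp; apply: compose_eq; first exact: mate_neq.
have [eqp eqEp] : inl p = attach true p /\ inl (E p) = attach true (E p).
  by rewrite capped_hook //; case: p cp => -[].
by rewrite eqp eqEp connect1 // /stack /= arcs_mate.
Qed.

Lemma compose_hook_free X p : ~~ capped p -> ~~ capped (X p) ->
  compose E X p = X p.
Proof.
move=> fp fXp; apply: compose_eq; first exact: mate_neq.
apply: connect_trans (free_attach X fp) _.
apply: connect_trans (stack_attach X p) _.
by rewrite stack_symC free_attach.
Qed.

(** The strand leaves [X] at a capped point, turns along the bottom arc of [E] and passes through
    [X] again; the last hypothesis excludes a second turn. *)
Lemma compose_hook_detour X p : ~~ capped p -> capped (X p) ->
  ~~ capped (X (E (X p))) -> compose E X p = X (E (X p)).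
Proof.
move=> fp cXp fq; apply: compose_eq.
  by apply/eqP => /(congr1 X) /eqP; rewrite mateK (negPf (mate_neq _ _)).
apply: connect_trans (free_attach X fp) _.
apply: connect_trans (stack_attach X p) _.
apply: connect_trans (capped_attach X cXp) _.
apply: connect_trans (stack_attach X _) _.
by rewrite stack_symC free_attach.
Qed.

(** A glued vertex goes straight to the top unless it is capped, and then one passage through [X]
    leads to a free point. *)
Lemma loops_hook_free X : (forall p, capped p -> ~~ capped (X p)) ->
  loops E X = 0%N.
Proof.
move=> fX; rewrite loopsE; apply: eq_card0 => v; rewrite !inE.
apply/negP => /andP[_ /forallP cv]; case: v cv => [p|j] /=.
  by move/(_ p); rewrite connect0.
have [cj|fj] := boolP (capped (true, j)).
  move/(_ (X (true, j)))/negP; apply.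
  apply: connect_trans (free_attach X (fX _ cj)) _; rewrite stack_symC.
  exact: (stack_attach X (true, j)).
by move/(_ (true, j))/negP; apply; apply: (free_attach X fj).
Qed.

(** The two capped points form a closed component; every other glued vertex runs to the top. *)
Lemma loops_hook_closed X p : capped p -> X p = E p ->
  (forall q, capped q -> q = p \/ q = E p) -> loops E X = 1%N.
Proof.
case: p => -[] a // ca XEa only_a; rewrite loopsE.
set e := stack E X.
have Ea := capped_hook ca; rewrite /= in Ea; rewrite Ea in XEa only_a.
(* At these two vertices the arcs of [E] and of [X] only join them to each other. *)
have comp v : connect e (inr a) v -> v = inr a \/ v = inr (t a).
  apply: (@connect_ind _ e (fun v => v = inr a \/ v = inr (t a))); first by left.
  move=> u w; case/orP => /existsP[q /andP[/eqP<- /eqP<-]].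
    case: q => -[] j; rewrite /attach /=; first by case.
    have cap c : t c != c -> E (false, c) = (false, t c).
      by move=> tc; rewrite ffunE /= (negPf tc).
    case=> -[->]; rewrite cap //=; [by right|by left; rewrite adj_tpermK|].
    by rewrite adj_tpermK eq_sym.
  case: q => -[] j; rewrite /attach /=; last by case.
  case=> -[->]; first by rewrite XEa /=; right.
  by rewrite -XEa mateK /=; left.
(* A single component counts for one; it remains to identify it with the set of vertices not joined
   to an outer point. *)
rewrite -(n_comp_connect (stack_symC X) (inr a)).
apply: eq_n_comp_r => v; rewrite !inE.
apply/forallP/idP => [cv|cav p].
  case: v cv => [p|j cv]; first by move/(_ p); rewrite connect0.
  have [/only_a[[->]|[->]]|fj] := boolP (capped (true, j)).
  - exact: connect0.
  - by have := stack_attach X (true, a); rewrite XEa.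
  by have /negP[] := cv (true, j); apply: (free_attach X fj).
apply/negP => pv; have := connect_trans cav (etrans (stack_symC X _ _) pv).
by case/comp.
Qed.

End Hook.

(** * Adjacent transpositions *)

Section AdjacentTranspositions.
Variable n : nat.
Implicit Types (a b x : 'I_n).

Lemma adj_tpermE i a b : nat_of_ord a = i.-1 -> nat_of_ord b = i ->
  adj_tperm n i = tperm a b.
Proof. by rewrite /adj_tperm => <- <-; rewrite !valK. Qed.

Lemma adj_tperm_endpoints i : (1 <= i < n)%N -> exists a b,
  [/\ a != b, nat_of_ord a = i.-1, nat_of_ord b = i & adj_tperm n i = tperm a b].
Proof.
case/andP=> i_gt0 ltin; have lti1n : (i.-1 < n)%N by rewrite (leq_ltn_trans (leq_pred i)).
exists (Ordinal lti1n), (Ordinal ltin); split=> //; last exact: adj_tpermE.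
by rewrite -val_eqE /= -[X in _ != X](prednK i_gt0) ltn_eqF.
Qed.

Lemma adj_tperm_fix i x : nat_of_ord x != i.-1 -> nat_of_ord x != i ->
  adj_tperm n i x = x.
Proof.
rewrite /adj_tperm => xi1 xi.
case: insubP => [u _ def_u|_]; last by rewrite perm1.
case: insubP => [w _ def_w|_]; last by rewrite perm1.
by rewrite tpermD // -val_eqE /= ?def_u ?def_w eq_sym.
Qed.

(** The supports, inside [{i - 1, i}] and [{j - 1, j}], are disjoint. *)
Lemma adj_tperm_far i j x : (1 <= i)%N -> (i.+1 < j)%N ->
  (adj_tperm n i x == x) || (adj_tperm n j x == x).
Proof.
move=> i_gt0 ltij.
have [/andP[xi1 xi]|] := boolP ((nat_of_ord x != i.-1) && (nat_of_ord x != i)).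
  by rewrite adj_tperm_fix ?eqxx.
by move=> xij; apply/orP; right; apply/eqP/adj_tperm_fix; lia.
Qed.

Lemma adj_tperm_comm i j x : (1 <= i)%N -> (i.+1 < j)%N ->
  adj_tperm n i (adj_tperm n j x) = adj_tperm n j (adj_tperm n i x).
Proof.
move=> i_gt0 ltij; have [/eqP ix|/eqP jx] := orP (adj_tperm_far x i_gt0 ltij).
  have [/eqP ijx|/eqP] := orP (adj_tperm_far (adj_tperm n j x) i_gt0 ltij).
    by rewrite ijx ix.
  by rewrite adj_tpermK => jx; rewrite ix -jx ix.
have [/eqP|/eqP jix] := orP (adj_tperm_far (adj_tperm n i x) i_gt0 ltij).
  by rewrite adj_tpermK => ix; rewrite jx -ix jx.
by rewrite jix jx.
Qed.

(** The witnesses are the positions [i - 1], [i] and [i + 1], counted from zero. *)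
Lemma adj_tperm_adjacent i : (1 <= i)%N -> (i.+1 < n)%N -> exists a b c : 'I_n,
  [/\ [/\ a != b, b != c & a != c], adj_tperm n i = tperm a b &
    adj_tperm n i.+1 = tperm b c].
Proof.
move=> i_gt0 ltin.
have [|a [b [nab def_a def_b ->]]] := @adj_tperm_endpoints i.
  by rewrite i_gt0 ltnW.
have [|b' [c [nbc def_b' def_c ->]]] := @adj_tperm_endpoints i.+1; first by [].
have eqb : b' = b by apply: val_inj; rewrite /= def_b' def_b.
rewrite eqb in nbc *; exists a, b, c; split=> //; split=> //.
by rewrite -val_eqE /= def_a def_c ltn_eqF // ltnS leq_pred.
Qed.

Lemma adj_tperm_braid i x : (1 <= i)%N -> (i.+1 < n)%N ->
  adj_tperm n i.+1 (adj_tperm n i (adj_tperm n i.+1 x)) =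
  adj_tperm n i (adj_tperm n i.+1 (adj_tperm n i x)).
Proof.
move=> i_gt0 /(adj_tperm_adjacent i_gt0)[a [b [c [[nab nbc nac] -> ->]]]].
have braid : (tperm b c * tperm a b * tperm b c = tperm a b * tperm b c * tperm a b)%g.
  (* As transpositions are their own inverses, each side is a conjugate; both equal [tperm a c]. *)
  rewrite -{1}[tperm b c]tpermV -{2}[tperm a b]tpermV -!mulgA -!conjgE !tpermJ.
  by rewrite tpermL !tpermR tpermD 1?eq_sym // tpermD // eq_sym.
by rewrite -!permM mulgA braid mulgA.
Qed.

End AdjacentTranspositions.

(** * Relations between hook and cross diagrams *)

Section DiagramRelations.
Variable n : nat.
Implicit Types (p : point n).

Lemma crossE i c (j : 'I_n) : cross_diagram n i (c, j) = (~~ c, adj_tperm n i j).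
Proof. by rewrite ffunE. Qed.

Lemma hookE i c (j : 'I_n) : hook_diagram n i (c, j) =
  if adj_tperm n i j == j then (~~ c, j) else (c, adj_tperm n i j).
Proof. by rewrite ffunE. Qed.

Lemma relabelE i (j : 'I_n) :
  (relabel i true (true, j) = (true, adj_tperm n i j)) *
  (relabel i false (false, j) = (false, adj_tperm n i j)) *
  (relabel i true (false, j) = (false, j)) *
  (relabel i false (true, j) = (true, j)).
Proof. by []. Qed.

Lemma compose_cross_cross i :
  compose (cross_diagram n i) (cross_diagram n i) = id_diagram n.
Proof.
by apply/diagramP => -[[] j]; rewrite compose_crossl !(relabelE, crossE) ffunE /= ?adj_tpermK.
Qed.

Lemma compose_hook_cross i :
  compose (hook_diagram n i) (cross_diagram n i) = hook_diagram n i.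
Proof.
apply/diagramP => -[[] j]; rewrite compose_crossr relabelE !hookE.
  by have [tj|_] := eqVneq; rewrite relabelE // tj.
by rewrite adj_tpermK eq_sym; have [tj|_] := eqVneq; rewrite relabelE // tj.
Qed.

Lemma compose_cross_hook i :
  compose (cross_diagram n i) (hook_diagram n i) = hook_diagram n i.
Proof.
apply/diagramP => -[[] j]; rewrite compose_crossl relabelE !hookE.
  by rewrite adj_tpermK eq_sym; have [tj|_] := eqVneq; rewrite relabelE // tj.
by have [tj|_] := eqVneq; rewrite relabelE // tj.
Qed.

(** Conjugation by a cross relabels arcs on both sides, which reduces the braid and conjugation
    relations to [adj_tperm_braid]. *)
Lemma cross_conjE i X c (j : 'I_n) :
  compose (compose (cross_diagram n i) X) (cross_diagram n i) (c, j) =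
  ((X (c, adj_tperm n i j)).1, adj_tperm n i (X (c, adj_tperm n i j)).2).
Proof.
rewrite compose_crossr compose_crossl /relabel.
by case: c => /=; case: (X _) => -[] k.
Qed.

Lemma compose_braid i : (1 <= i)%N -> (i.+1 < n)%N ->
  compose (compose (cross_diagram n i.+1) (cross_diagram n i)) (cross_diagram n i.+1) =
  compose (compose (cross_diagram n i) (cross_diagram n i.+1)) (cross_diagram n i).
Proof.
move=> i_gt0 ltin; apply/diagramP => -[c j]; rewrite !cross_conjE !crossE /=.
by rewrite adj_tperm_braid.
Qed.

Lemma compose_hook_conj i : (1 <= i)%N -> (i.+1 < n)%N ->
  compose (compose (cross_diagram n i.+1) (hook_diagram n i)) (cross_diagram n i.+1) =
  compose (compose (cross_diagram n i) (hook_diagram n i.+1)) (cross_diagram n i).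
Proof.
move=> i_gt0 ltin; apply/diagramP => -[c j]; rewrite !cross_conjE !hookE /=.
(* By the braid relation both hooks take the same branch at [j]. *)
have -> : (adj_tperm n i (adj_tperm n i.+1 j) == adj_tperm n i.+1 j) =
    (adj_tperm n i.+1 (adj_tperm n i j) == adj_tperm n i j).
  rewrite -(inj_eq (inv_inj (@adj_tpermK n i.+1))) adj_tpermK adj_tperm_braid //.
  by rewrite -(inj_eq (inv_inj (@adj_tpermK n i))) adj_tpermK.
by case: ifP; rewrite /= ?adj_tpermK ?adj_tperm_braid.
Qed.

Section FarCommutation.
Variables i j : nat.
Hypothesis commij : forall x : 'I_n,
  adj_tperm n i (adj_tperm n j x) = adj_tperm n j (adj_tperm n i x).

Lemma compose_cross_comm : compose (cross_diagram n i) (cross_diagram n j) =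
  compose (cross_diagram n j) (cross_diagram n i).
Proof.
by apply/diagramP => -[[] x]; rewrite !compose_crossl !(relabelE, crossE) ?commij.
Qed.

Lemma compose_hook_cross_comm :
  compose (hook_diagram n i) (cross_diagram n j) =
  compose (cross_diagram n j) (hook_diagram n i).
Proof.
have eqt x : (adj_tperm n i (adj_tperm n j x) == adj_tperm n j x) =
    (adj_tperm n i x == x).
  by rewrite commij (inj_eq (inv_inj (@adj_tpermK n j))).
apply/diagramP => -[[] x]; rewrite compose_crossl compose_crossr !relabelE;
  by rewrite !hookE eqt; case: ifP => tix; rewrite !relabelE ?commij ?adj_tpermK.
Qed.

End FarCommutation.

(** The two arcs that meet in the middle close up into the single loop. *)
Lemma loops_hook_hook i : (1 <= i < n)%N ->
  loops (hook_diagram n i) (hook_diagram n i) = 1%N.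
Proof.
move=> /adj_tperm_endpoints[a [b [nab _ _ t_ab]]].
have ca : capped i (true, a) by rewrite /capped /= t_ab tpermL eq_sym.
apply: (@loops_hook_closed _ _ _ (true, a)) => // -[c x] /andP[/= ->].
rewrite hookE t_ab tpermL ifN_eqC //; case: tpermP => [->|->|]; [by left|by right|].
by rewrite eqxx.
Qed.

Lemma compose_hook_hook i :
  compose (hook_diagram n i) (hook_diagram n i) = hook_diagram n i.
Proof.
apply/diagramP => -[c x]; have [cap|free] := boolP (capped i (c, x)).
  exact: compose_hook_capped.
apply: compose_hook_free => //; rewrite hookE; move: free; rewrite /capped /= negb_and negbK.
by case: c => /= [->//|_]; case: ifP => //= ->.
Qed.

Section FarHooks.
Variables i j : nat.
Hypothesis far : forall x : 'I_n, (adj_tperm n i x == x) || (adj_tperm n j x == x).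

Lemma loops_hook_far : loops (hook_diagram n i) (hook_diagram n j) = 0%N.
Proof.
apply: loops_hook_free => -[c x] /andP[/= -> tix].
by have := far x; rewrite (negPf tix) /= hookE => ->.
Qed.

Lemma compose_hook_far p : compose (hook_diagram n i) (hook_diagram n j) p =
  if adj_tperm n i p.2 != p.2 then hook_diagram n i p else hook_diagram n j p.
Proof.
case: p => c x /=; have [tix|tix] := eqVneq (adj_tperm n i x) x.
  apply: compose_hook_free; rewrite /capped ?tix ?eqxx ?andbF //= hookE.
  case: ifP => /= tjx; first by rewrite tix eqxx andbF.
  have := far (adj_tperm n j x); rewrite adj_tpermK [x == _]eq_sym tjx orbF.
  by move=> ->; rewrite andbF.
have /eqP tjx : adj_tperm n j x == x by have := far x; rewrite (negPf tix).
case: c; first by apply: compose_hook_capped; rewrite /capped.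
have hjx c : hook_diagram n j (c, x) = (~~ c, x) by rewrite hookE tjx eqxx.
have hix c : hook_diagram n i (c, x) = (c, adj_tperm n i x) by rewrite hookE (negPf tix).
have /eqP tjtix : adj_tperm n j (adj_tperm n i x) == adj_tperm n i x.
  by have := far (adj_tperm n i x); rewrite adj_tpermK eq_sym (negPf tix).
have hji c : hook_diagram n j (c, adj_tperm n i x) = (~~ c, adj_tperm n i x).
  by rewrite hookE tjtix eqxx.
(* A bottom point moved by [i] climbs through the lower diagram, follows the bottom arc of the upper
   hook and descends again. *)
rewrite compose_hook_detour; first by rewrite hjx /= !hix hji.
- by [].
- by rewrite hjx.
- by rewrite hjx /= hix hji.
Qed.

End FarHooks.

Lemma compose_hook_comm i j :
  (forall x : 'I_n, (adj_tperm n i x == x) || (adj_tperm n j x == x)) ->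
  compose (hook_diagram n i) (hook_diagram n j) =
  compose (hook_diagram n j) (hook_diagram n i).
Proof.
move=> far; apply/diagramP => p; rewrite !compose_hook_far // => [|x]; last by rewrite orbC.
case: p => c x /=; have := far x; rewrite !hookE.
have [ti|ti] := eqVneq (adj_tperm n i x) x; last by rewrite /= => ->.
by case: ifP => //= tj _; rewrite tj.
Qed.

Section HookCrossHook.
Variable i : nat.
Hypotheses (i_gt0 : (1 <= i)%N) (ltin : (i.+1 < n)%N).
Let X := compose (cross_diagram n i) (hook_diagram n i.+1).

(** The arcs are computed on the three positions [a], [b], [c]; all other strands are vertical. *)
Lemma hook_cross_hook_diagrams : loops (hook_diagram n i.+1) X = 0%N /\
  compose (hook_diagram n i.+1) X = hook_diagram n i.+1.
Proof.
have [a [b [c [[nab nbc nac] t0 t1]]]] := adj_tperm_adjacent i_gt0 ltin.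
have XE q : X q = relabel i true (hook_diagram n i.+1 (relabel i true q)).
  exact: compose_crossl.
have [t0a t0b t0c] : [/\ adj_tperm n i a = b, adj_tperm n i b = a &
    adj_tperm n i c = c].
  by rewrite t0 tpermL tpermR tpermD.
have [t1a t1b t1c] : [/\ adj_tperm n i.+1 a = a, adj_tperm n i.+1 b = c &
    adj_tperm n i.+1 c = b].
  by rewrite t1 tpermL tpermR tpermD // eq_sym.
have [h1a h1b h1c] : [/\ forall s, hook_diagram n i.+1 (s, a) = (~~ s, a),
    forall s, hook_diagram n i.+1 (s, b) = (s, c) &
    forall s, hook_diagram n i.+1 (s, c) = (s, b)].
  by split=> s; rewrite hookE ?t1a ?t1b ?t1c ?eqxx // ifN_eq // eq_sym.
have Xtop : [/\ X (true, a) = (true, c), X (true, b) = (false, a) &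
    X (true, c) = (true, a)].
  by rewrite !XE !relabelE t0a t0b t0c h1a h1b h1c !relabelE t0c t0b.
have Xbot : [/\ X (false, a) = (true, b), X (false, b) = (false, c) &
    X (false, c) = (false, b)].
  by rewrite !XE !relabelE h1a h1b h1c !relabelE t0a.
have Xfix s j : j != a -> j != b -> j != c -> X (s, j) = (~~ s, j).
  move=> ja jb jc; have [t0j t1j] : adj_tperm n i j = j /\ adj_tperm n i.+1 j = j.
    by rewrite t0 t1 !tpermD // eq_sym.
  by rewrite XE; case: s; rewrite relabelE ?t0j hookE t1j eqxx relabelE ?t0j.
have [[Xta Xtb Xtc] [Xba Xbb Xbc]] := (Xtop, Xbot).
have capE s j : capped i.+1 (s, j) = s && ((j == b) || (j == c)).
  rewrite /capped /= t1; case: tpermP => [->|->|/eqP jb /eqP jc].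
  - by rewrite eqxx eq_sym nbc.
  - by rewrite eqxx nbc orbT.
  - by rewrite eqxx (negPf jb) (negPf jc).
have [ab ac] : (a == b = false) /\ (a == c = false) by rewrite (negPf nab) (negPf nac).
split.
  apply: loops_hook_free => -[s j]; rewrite capE => /andP[-> /orP[]/eqP->].
    by rewrite Xtb capE.
  by rewrite Xtc capE ab ac.
apply/diagramP => -[s j]; have [|free] := boolP (capped i.+1 (s, j)).
  exact: compose_hook_capped.
(* The strand at [a] is a zigzag: from top [a] to top [c] in [X], along the hook to [b], then down
   to bottom [a]. *)
have [eqj|ja] := eqVneq j a.
  rewrite eqj h1a; case: s {free};
    rewrite compose_hook_detour ?Xta ?Xba ?h1b ?h1c ?Xtb ?Xtc //;
    by rewrite capE ?ab ?ac ?eqxx ?orbT.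
have [eqj|jb] := eqVneq j b.
  rewrite eqj h1b; case: s free; rewrite eqj capE eqxx // => _.
  by rewrite compose_hook_free ?Xbb // capE.
have [eqj|jc] := eqVneq j c.
  rewrite eqj h1c; case: s free; rewrite eqj capE eqxx ?orbT // => _.
  by rewrite compose_hook_free ?Xbc // capE.
rewrite compose_hook_free ?Xfix //; last by rewrite capE (negPf jb) (negPf jc) andbF.
by rewrite hookE t1 tpermD ?eqxx // eq_sym.
Qed.

End HookCrossHook.

End DiagramRelations.

(** * The relations in the diagram algebra, and the theorem *)

(** Among these products a loop occurs only in the square of a hook; all others have coefficient
    [1]. *)
Lemma vtl_brauer_relations (K : fieldType) (d : K) n :
  @brauer_relations K (vtl d n) d n
    (fun i => basis d (hook_diagram n i)) (fun i => basis d (cross_diagram n i)).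
Proof.
have M0 (X Y : diagram n) : loops X Y = 0%N ->
    basis d X * basis d Y = basis d (compose X Y).
  by move=> XY0; rewrite basisM XY0 expr0 scale1r.
split.
- by move=> i _; rewrite M0 ?loops_crossl // compose_cross_cross basis1.
- move=> i lti; rewrite basisM loops_hook_hook // compose_hook_hook.
  by rewrite expr1.
- by move=> i _; rewrite M0 ?loops_crossr // compose_hook_cross.
- by move=> i _; rewrite M0 ?loops_crossl // compose_cross_hook.
- by move=> i i_gt0 ltin; rewrite !M0 ?loops_crossl ?loops_crossr // compose_braid.
- by move=> i i_gt0 ltin; rewrite !M0 ?loops_crossl ?loops_crossr // compose_hook_conj.
- move=> i i_gt0 ltin; have [L C] := hook_cross_hook_diagrams i_gt0 ltin.
  by rewrite -mulrA (M0 (cross_diagram n i)) ?loops_crossl // M0 // C.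
- move=> i j i_gt0 /andP[ltij _].
  have comm x := adj_tperm_comm (n := n) x i_gt0 ltij.
  have far x := adj_tperm_far (n := n) x i_gt0 ltij.
  have far' x : (adj_tperm n j x == x) || (adj_tperm n i x == x) by rewrite orbC.
  rewrite !M0 ?loops_crossl ?loops_crossr ?loops_hook_far //; split.
  + by rewrite (compose_hook_comm far).
  + by rewrite compose_hook_cross_comm.
  + by rewrite -compose_hook_cross_comm.
  + by rewrite compose_cross_comm.
Qed.

Theorem lemma2p6 (R : realType) (n : nat) (hn : (1 <= n)%N)
    (f : nat -> VTL R n)
    (f1 : f 1%N = 1)
    (fS : forall i : nat, (2 <= i <= n)%N ->
      f i = coef_x R (i - 1) *: f (i - 1)%N
        + coef_y R (i - 1) *: (f (i - 1)%N * vtl_e R n (i - 1) * f (i - 1)%N)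
        + coef_z R (i - 1) *: (f (i - 1)%N * vtl_v R n (i - 1) * f (i - 1)%N)) :
  (forall i : nat, (1 <= i <= n)%N -> f i ^+ 2 = f i)
  /\ (forall i : nat, (1 <= i <= n - 1)%N ->
      f i.+1 * f i = f i.+1 /\ f i * f i.+1 = f i.+1)
  /\ (forall i k : nat, (1 <= i <= n)%N -> (1 <= k < i)%N ->
      f i * vtl_e R n k = 0 /\ vtl_e R n k * f i = 0)
  /\ (forall i k : nat, (1 <= i <= n)%N -> (1 <= k < i)%N ->
      f i * vtl_v R n k = f i /\ vtl_v R n k * f i = f i)
  /\ (forall i : nat, (1 <= i <= n - 1)%N ->
      (vtl_e R n i * f i) ^+ 2 = coef_alpha R (i - 1) *: (vtl_e R n i * f i)
      /\ (f i * vtl_e R n i) ^+ 2 = coef_alpha R (i - 1) *: (f i * vtl_e R n i))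
  /\ (forall i : nat, (1 <= i <= n - 1)%N ->
      f i * vtl_v R n i * f i * vtl_v R n i * f i =
        coef_x R (i - 1) *: f i
        + coef_y R (i - 1) *: (f i * vtl_e R n i * f i)
        + coef_z R (i - 1) *: (f i * vtl_v R n i * f i))
  /\ (forall i : nat, (1 <= i <= n - 1)%N ->
      vtl_e R n i * f i * vtl_v R n i * f i =
        (coef_x R (i - 1) + coef_y R (i - 1)) *: (vtl_e R n i * f i)
      /\ f i * vtl_v R n i * f i * vtl_e R n i =
        (coef_x R (i - 1) + coef_y R (i - 1)) *: (f i * vtl_e R n i)).
Proof.
have rel : @brauer_relations _ (VTL R n) (dvar R) n (vtl_e R n) (vtl_v R n).
  exact: vtl_brauer_relations.
have coefs := vtl_coefs R.
(* The given recursion is indexed by its left side, from 2 on; [projector_rec] by its right side,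
   from 1 on. *)
have rec : projector_rec n (coef_x R) (coef_y R) (coef_z R) (vtl_e R n) (vtl_v R n) f.
  by move=> i /andP[i_gt0 ltin]; have := fS i.+1; rewrite subn1 /= ltnS i_gt0 ltin => ->.
have ts := projector_traceless_symmetric rel coefs f1 rec.
have lt_n i : (1 <= i <= n - 1)%N -> (1 <= i < n)%N.
  by case: n hn {fS f f1 rel rec ts} => // m _; rewrite subn1.
split; first by move=> i /ts/ts_idem; rewrite expr2.
split; first by move=> i /lt_n; apply: projector_absorb rel coefs f1 rec i.
split; first by move=> i k /ts/ts_hook; apply.
split; first by move=> i k /ts/ts_cross; apply.
split.
  by move=> i /lt_n lti; rewrite subn1; apply: projector_hook_sq rel coefs f1 rec i lti.
split.
  by move=> i /lt_n lti; rewrite subn1; apply: projector_cross_cross rel coefs f1 rec i lti.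
by move=> i /lt_n lti; rewrite subn1; apply: projector_hook_cross rel coefs f1 rec i lti.
Qed.
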